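(* Let $r_1,r_2,m_1,m_2>0$ with $r_1+r_2\le1$, $m_1+m_2=1$ and $r_1m_1=r_2m_2$, and let $\mu$ be the self-similar measure on $[0,1]$ determined by $S_1(x)=r_1x$, $S_2(x)=r_2x+1-r_2$ and weights $(m_1,m_2)$. Let $l\in\mathbb{N}=\{1,2,\dots\}$ be odd. Then: (i) If $m_1=m_2$, then for all $k\in\mathbb{N}$, $\|\tilde f_{2^kl}\|_\infty=\|\tilde f_l\|_\infty$. (ii) If $m_1<m_2$, then $C:=\dfrac{1}{\sqrt{m_1\bigl(1+\frac{m_1}{m_2}\bigr)}}>1$, and for all $k\in\mathbb{N}$, $$\|\tilde f_{2^kl}\|_\infty\ge C^k\,\|\tilde f_l\|_\infty.$$ Additionally, for all $k\in\mathbb{N}$, $$\|\tilde f_{2^kl}\|_\infty\le m_1^{-\frac k2}\Bigl(\frac{m_2}{m_1}\Bigr)^{\frac k2(2^k-1)}\|\tilde f_l\|_\infty.$$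
   Context: The self-similar measure $\mu$ is the unique Borel probability measure on $[0,1]$ with $\mu(B)=m_1\,\mu(S_1^{-1}(B))+m_2\,\mu(S_2^{-1}(B))$ for all Borel sets $B$ (it is non-atomic). Derivatives with respect to a measure: for a non-atomic Borel probability measure $\nu$ on $[0,1]$ and $f\colon[0,1]\to\mathbb{R}$, $h\in L_2([0,1],\nu)$ is the $\nu$-derivative $\frac{df}{d\nu}$ of $f$ if $f(x)=f(0)+\int_0^x h\,d\nu$ for all $x\in[0,1]$. $H^1(\nu)$ is the space of functions possessing a $\nu$-derivative. For Lebesgue measure the derivative is written $f'$. $H^2(\lambda,\mu)$ (index $\lambda$: Lebesgue measure) is the space of all $f$ possessing a Lebesgue derivative $f'$ (that is, $f'$ is square-integrable with respect to Lebesgue measure and $f(x)=f(0)+\int_0^x f'(t)\,dt$ for all $x\in[0,1]$) belonging to $H^1(\mu)$ (so $f'$ is taken continuous). A Neumann eigenvalue is a real $\Lambda$ such that there is a non-zero $f\in H^2(\lambda,\mu)$ with $\frac{d}{d\mu}f'=-\Lambda f$, $f'(0)=f'(1)=0$. The Neumann eigenvalues form a strictly increasing sequence $0=\lambda_{N,0}<\lambda_{N,1}<\cdots\to\infty$; they are exactly the squares of the non-negative zeros of $\sin_\mu^N(z)=\sum_{n\ge0}(-1)^n p_{2n+1}(1)z^{2n+1}$. Here $p_0(x)=1$ and, for $n\ge1$, $p_n(x)=\int_0^x p_{n-1}\,d\mu$ if $n$ is odd, $p_n(x)=\int_0^x p_{n-1}(t)\,dt$ if $n$ is even. The $m$th Neumann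 eigenfunction is $f_m(x)=c_{\lambda,\mu}(\sqrt{\lambda_{N,m}},x)$ with $c_{\lambda,\mu}(z,x)=\sum_{n\ge0}(-1)^n z^{2n}p_{2n}(x)$, and $\tilde f_m=\|f_m\|_{L_2(\mu)}^{-1}f_m$. $\|\cdot\|_\infty$ is the supremum norm on $[0,1]$. Known fact used throughout (due to Volkmer and Freiberg): if $r_1m_1=r_2m_2$ then $r_1m_1\,\lambda_{N,2m}=\lambda_{N,m}$ for all $m\in\mathbb{N}$. *)

(* Defs.v *)
From HB Require Import structures.
From mathcomp Require Import all_boot all_order all_algebra.
From mathcomp Require Import all_classical all_reals all_analysis.

Set Implicit Arguments.
Unset Strict Implicit.
Unset Printing Implicit Defensive.

Import Order.TTheory GRing.Theory Num.Theory.
Import numFieldNormedType.Exports.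

Local Open Scope classical_set_scope.
Local Open Scope ring_scope.

(* A function on [0,1] is encoded as a function R -> R; no definition below
   depends on its values outside [0,1]. A measure on [0,1] is encoded as a
   Borel measure on R giving full mass to [0,1]. *)

Section self_similar_measure.
Context {R : realType}.

(* S_1 is [fun x => r1 * x] and S_2 is [fun x => r2 * x + 1 - r2]. *)
Definition self_similar_measure (r1 r2 m1 m2 : R)
    (mu : probability (measurableTypeR R) R) : Prop :=
  mu `[0, 1]%classic = 1%E /\
  forall B : set (measurableTypeR R), measurable B ->
    mu B = (m1%:E * mu ((fun x : R => (r1 * x)%R) @^-1` B) +
            m2%:E * mu ((fun x : R => (r2 * x + 1 - r2)%R) @^-1` B))%E.

End self_similar_measure.

Section measure_derivative.
Context {R : realType}.
Implicit Types (nu mu : {measure set (measurableTypeR R) -> \bar R}).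
Implicit Types (f g h : R -> R).

(* h is (a version of) df/dnu; the restriction [h \_ `[0, 1]], which is 0
   outside [0,1], being in Lfun says that h is in L_2([0,1], nu). *)
Definition is_measure_derivative nu f h : Prop :=
  h \_ `[0, 1]%classic \in Lfun nu 2%:E /\
  forall x : R, 0 <= x <= 1 -> f x = f 0 + \int[nu]_(t in `[0, x]) h t.

Definition H1 nu f : Prop := exists h, is_measure_derivative nu f h.

(* f is in H^2(lambda, mu) and g is the representative of f' lying in H^1(mu).
   As mu is non-atomic, such a g is continuous on [0,1], so it is unique there
   and its boundary values are well defined. *)
Definition H2_with_derivative mu f g : Prop :=
  is_measure_derivative lebesgue_measure f g /\ H1 mu g.

Definition neumann_eigenvalue mu (L : R) : Prop :=
  exists f g,
    [/\ exists2 x, 0 <= x <= 1 & f x != 0,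
        H2_with_derivative mu f g,
        is_measure_derivative mu g (fun x => - L * f x),
        g 0 = 0 &
        g 1 = 0].

(* [lam m] is the m-th Neumann eigenvalue lambda_{N,m}, counted from 0: these
   two conditions determine the sequence [lam] uniquely. *)
Definition neumann_eigenvalue_sequence mu (lam : nat -> R) : Prop :=
  {homo lam : i j / (i < j)%N >-> i < j} /\ range lam = neumann_eigenvalue mu.

End measure_derivative.

Section eigenfunctions.
Context {R : realType}.
Variable mu : {measure set (measurableTypeR R) -> \bar R}.

Fixpoint p_fun (n : nat) : R -> R :=
  if n is n'.+1 then
    if odd n then fun x => \int[mu]_(t in `[0, x]) p_fun n' t
    else fun x => \int[lebesgue_measure]_(t in `[0, x]) p_fun n' t
  else fun=> 1.

Definition c_fun (z x : R) : R :=
  limn (series (fun n => (-1) ^+ n * z ^+ (2 * n) * p_fun (2 * n) x)).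

Definition neumann_eigenfunction (lam : nat -> R) (m : nat) : R -> R :=
  c_fun (Num.sqrt (lam m)).

Definition L2_norm (f : R -> R) : R :=
  fine (Lnorm mu 2%:E (EFin \o (f \_ `[0, 1]%classic))).

Definition normalized_eigenfunction (lam : nat -> R) (m : nat) : R -> R :=
  fun x => (L2_norm (neumann_eigenfunction lam m))^-1 *
           neumann_eigenfunction lam m x.

End eigenfunctions.

(* The supremum is taken in the extended reals, where it always exists. *)
Definition sup_norm {R : realType} (f : R -> R) : \bar R :=
  ereal_sup [set `|f x|%:E | x in `[0, 1]%classic].

(* Main.v *)
(* Write c_L for the solution of (c')' = - L c with c(0) = 1, c'(0) = 0, where the
   outer derivative is taken with respect to mu, and G(L) = c_L'(1), so that the
   eigenvalues are the zeros of G; let rho = r1 m1 = r2 m2.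

   By self-similarity c_L o S_1 = c_(rho L), and c_L o S_2 solves the equation
   with parameter rho L as well, with initial slope (r2 / r1) G(rho L). If
   G(rho L) = 0, then c_L o S_2 = c_(rho L)(1) c_(rho L), hence G(L) = 0 and
   c_L(1) = c_(rho L)(1)^2 > 0. If G(L) = 0 and G(rho L) <> 0, then Lagrange's
   identity for the two pieces gives c_L(1) = - r2 / r1 = - m1 / m2 < 0.

   Lagrange's identity for c_K and c_L at an eigenvalue L,
   G(K) c_L(1) = (L - K) \int c_K c_L dmu, shows that the sign of c_L(1)
   alternates between consecutive eigenvalues. Therefore rho lambda_i is an
   eigenvalue exactly when i is even, which yields rho lambda_(2m) = lambda_m
   without oscillation theory.

   With a_m = f_m(1) it follows that ||f_(2m)||^2 = (m1 + m2 a_m^2) ||f_m||^2 in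
   L_2(mu), that ||f_(2m)||_oo = max(1, |a_m|) ||f_m||_oo and a_(2m) = a_m^2,
   while a_l = - m1 / m2 for odd l; the estimates are then elementary. *)

Require Import Defs.
From HB Require Import structures.
From mathcomp Require Import all_boot all_order all_algebra.
From mathcomp Require Import all_classical all_reals all_analysis.
From mathcomp Require Import measurable_realfun.
From mathcomp Require Import ring lra.

Set Implicit Arguments.
Unset Strict Implicit.
Unset Printing Implicit Defensive.

Import Order.TTheory GRing.Theory Num.Theory.
Import numFieldNormedType.Exports.

Local Open Scope classical_set_scope.
Local Open Scope ring_scope.

(** * Cumulative integrals on the unit interval *)

Section cumulative_integral.
Context {R : realType}.
Implicit Types (nu : {measure set (measurableTypeR R) -> \bar R}).
Implicit Types (f g h : R -> R).

Notation I01 := (`[(0:R), 1]%classic).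

(** The interval is closed, so an atom of [nu] at 0 would contribute; [nu [set 0] = 0] is assumed
    wherever the value at 0 matters. *)
Definition cumint nu h (x : R) : R := \int[nu]_(t in `[0, x]) h t.

(** The working class of functions: stable under algebra and [cumint], and integrable on [0,1] for
    every measure of mass 1 there, so that integrals may be combined linearly. *)
Definition bounded_measurable h : Prop :=
  measurable_fun I01 h /\ exists M, forall x, 0 <= x <= 1 -> `|h x| <= M.

Lemma sub_itv01 (x : R) : x <= 1 -> `[0, x]%classic `<=` I01.
Proof. by move=> x1 y /=; rewrite !in_itv/= => /andP[-> /le_trans]; exact. Qed.

Lemma mem_itv01 (x : R) : I01 x <-> 0 <= x <= 1.
Proof. by rewrite /= in_itv/=. Qed.

Lemma bounded_measurable_cst (c : R) : bounded_measurable (fun=> c).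
Proof. by split; [exact: measurable_cst|exists `|c|]. Qed.

Lemma bounded_measurableD f g : bounded_measurable f -> bounded_measurable g ->
  bounded_measurable (fun x => f x + g x).
Proof.
move=> [mf [M fM]] [mg [N gN]]; split; first exact: measurable_funD.
exists (M + N) => x x01; apply: (le_trans (ler_normD _ _)).
by rewrite lerD ?fM ?gN.
Qed.

Lemma bounded_measurableM f g : bounded_measurable f -> bounded_measurable g ->
  bounded_measurable (fun x => f x * g x).
Proof.
move=> [mf [M fM]] [mg [N gN]]; split; first exact: measurable_funM.
by exists (M * N) => x x01; rewrite normrM ler_pM ?fM ?gN.
Qed.

Lemma bounded_measurableZ (c : R) f : bounded_measurable f ->
  bounded_measurable (fun x => c * f x).
Proof. exact/bounded_measurableM/bounded_measurable_cst. Qed.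

Lemma bounded_measurableB f g : bounded_measurable f -> bounded_measurable g ->
  bounded_measurable (fun x => f x - g x).
Proof.
move=> bf bg; rewrite (_ : (fun x => _) = (fun x => f x + (-1) * g x)).
  exact/bounded_measurableD/bounded_measurableZ.
by apply/funext => x; rewrite mulN1r.
Qed.

Lemma bounded_measurable_norm f : bounded_measurable f ->
  bounded_measurable (fun x => `|f x|).
Proof.
move=> [mf [M fM]]; split; last by exists M => x /fM; rewrite normr_id.
exact: (@measurableT_comp _ _ _ _ _ _ (@Num.norm R R)).
Qed.

Lemma eq_bounded_measurable f g : (forall x, 0 <= x <= 1 -> f x = g x) ->
  bounded_measurable f -> bounded_measurable g.
Proof.
move=> fg [mf [M fM]]; split.
  by apply: eq_measurable_fun mf => x; rewrite inE => /mem_itv01 /fg.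
by exists M => x x01; rewrite -fg// fM.
Qed.

Lemma bounded_measurable_integrable nu h (D : set (measurableTypeR R)) :
  nu I01 = 1%E -> bounded_measurable h -> measurable D -> D `<=` I01 ->
  nu.-integrable D (EFin \o h).
Proof.
move=> nu1 [mh [M hM]] mD DI; apply: measurable_bounded_integrable => //.
- by rewrite (@le_lt_trans _ _ (nu I01)) ?le_measure ?inE// nu1 ltry.
- exact: measurable_funS mh.
- exists M; split; first exact: num_real.
  by move=> N MN x /DI /mem_itv01 /hM /le_trans; apply; exact: ltW.
Qed.

Lemma bounded_measurable_integrable_itv nu h (x : R) :
  nu I01 = 1%E -> bounded_measurable h -> x <= 1 ->
  nu.-integrable `[0, x] (EFin \o h).
Proof.
move=> nu1 bh x1; apply: bounded_measurable_integrable => //.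
exact: sub_itv01.
Qed.

Lemma fine_itv01_le1 nu (x : R) : nu I01 = 1%E -> x <= 1 ->
  0 <= fine (nu `[0, x]%classic) <= 1.
Proof.
move=> nu1 x1; rewrite fine_ge0 ?measure_ge0//=.
have le1 : (nu `[0%R, x]%classic <= 1)%E.
  rewrite -nu1; apply: le_measure; rewrite ?inE//; exact: sub_itv01.
by rewrite -lee_fin fineK// ge0_fin_numE// (le_lt_trans le1)// ltry.
Qed.

Lemma eq_cumint nu f g (x : R) : x <= 1 ->
  (forall t, 0 <= t <= 1 -> f t = g t) -> cumint nu f x = cumint nu g x.
Proof.
move=> x1 fg; apply: eq_Rintegral => t; rewrite inE => /(sub_itv01 x1).
by move=> /mem_itv01 /fg.
Qed.

Lemma cumintD nu f g (x : R) : nu I01 = 1%E -> x <= 1 ->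
  bounded_measurable f -> bounded_measurable g ->
  cumint nu (fun t => f t + g t) x = cumint nu f x + cumint nu g x.
Proof.
by move=> nu1 x1 bf bg; rewrite /cumint RintegralD//;
  exact: bounded_measurable_integrable_itv.
Qed.

Lemma cumintB nu f g (x : R) : nu I01 = 1%E -> x <= 1 ->
  bounded_measurable f -> bounded_measurable g ->
  cumint nu (fun t => f t - g t) x = cumint nu f x - cumint nu g x.
Proof.
by move=> nu1 x1 bf bg; rewrite /cumint RintegralB//;
  exact: bounded_measurable_integrable_itv.
Qed.

Lemma cumintZ nu (c : R) f (x : R) : nu I01 = 1%E -> x <= 1 ->
  bounded_measurable f -> cumint nu (fun t => c * f t) x = c * cumint nu f x.
Proof.
by move=> nu1 x1 bf; rewrite /cumint RintegralZl//;
  exact: bounded_measurable_integrable_itv.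
Qed.

Lemma le_cumint nu f g (x : R) : nu I01 = 1%E -> x <= 1 ->
  bounded_measurable f -> bounded_measurable g ->
  (forall t, 0 <= t <= x -> f t <= g t) -> cumint nu f x <= cumint nu g x.
Proof.
move=> nu1 x1 bf bg fg; apply: le_Rintegral => //.
- exact: bounded_measurable_integrable_itv.
- exact: bounded_measurable_integrable_itv.
Qed.

Lemma cumint_cst nu (c x : R) :
  cumint nu (fun=> c) x = c * fine (nu `[0, x]%classic).
Proof. by rewrite /cumint Rintegral_cst. Qed.

Lemma cumint_cst1 nu (c : R) : nu I01 = 1%E -> cumint nu (fun=> c) 1 = c.
Proof. by move=> nu1; rewrite cumint_cst nu1 mulr1. Qed.

Lemma cumint_at0 nu h : nu [set 0] = 0%E -> cumint nu h 0 = 0.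
Proof.
move=> nu0; rewrite /cumint set_itv1 /Rintegral null_set_integral//.
exact: measurable_fun_set1.
Qed.

Lemma norm_cumint_le nu f (x M : R) : nu I01 = 1%E -> 0 <= x <= 1 ->
  bounded_measurable f -> (forall t, 0 <= t <= x -> `|f t| <= M) ->
  `|cumint nu f x| <= M.
Proof.
move=> nu1 /andP[x0 x1] bf fM.
have M0 : 0 <= M by apply: le_trans (fM 0 _) => //; rewrite lexx x0.
apply: (@le_trans _ _ (cumint nu (fun t => `|f t|) x)).
  by apply: le_normr_Rintegral => //; exact: bounded_measurable_integrable_itv.
apply: (@le_trans _ _ (cumint nu (fun=> M) x)).
  apply: le_cumint => //; first exact: bounded_measurable_norm.
  exact: bounded_measurable_cst.
by rewrite cumint_cst ler_piMr//; case/andP: (fine_itv01_le1 nu1 x1).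
Qed.

Lemma norm_cumint nu f (x : R) : nu I01 = 1%E -> x <= 1 ->
  bounded_measurable f -> `|cumint nu f x| <= cumint nu (fun t => `|f t|) x.
Proof.
by move=> nu1 x1 bf; apply: le_normr_Rintegral => //;
  exact: bounded_measurable_integrable_itv.
Qed.

Lemma cumint_ge0 nu f (x : R) : (forall t, 0 <= t <= x -> 0 <= f t) ->
  0 <= cumint nu f x.
Proof. by move=> f0; apply: Rintegral_ge0 => t /=; rewrite in_itv/= => /f0. Qed.

(** The cumulative integral of a nonnegative function is nondecreasing, hence Borel; cutting [h] off
    outside [0,1] makes this monotonicity hold on the whole line. *)
Lemma cumint_nonneg_measurable nu h :
  nu.-integrable I01 (EFin \o h) -> (forall t, 0 <= t <= 1 -> 0 <= h t) ->
  measurable_fun I01 (cumint nu h).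
Proof.
move=> ih h0.
have ih' : nu.-integrable setT (EFin \o (h \_ I01)).
  by move/(integrable_mkcond _ _).1: ih; rewrite restrict_EFin; exact.
pose H x := \int[nu]_(t in `[0, x]) (h \_ I01) t.
have hI0 t : 0 <= (h \_ I01) t.
  by rewrite patchE; case: ifPn => //; rewrite inE => /mem_itv01 /h0.
apply: (@eq_measurable_fun _ _ _ _ _ H).
  move=> x; rewrite inE => /mem_itv01 /andP[x0 x1]; apply: eq_Rintegral => t.
  rewrite inE => /(sub_itv01 x1) tI; rewrite patchE ifT//; exact/mem_set.
apply: nondecreasing_measurable => // x y xy; rewrite /H /Rintegral.
have fn z : (\int[nu]_(t in `[0%R, z]) ((h \_ I01) t)%:E)%E \is a fin_num.
  apply: integrable_fin_num => //; exact: integrableS ih'.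
apply: fine_le => //; apply: ge0_subset_integral => //.
- by apply: measurable_funTS; exact: (measurable_int nu ih').
- by move=> t _; rewrite lee_fin.
- by move=> t /=; rewrite !in_itv/= => /andP[-> /le_trans]; exact.
Qed.

(** Measurability comes from writing [h] as [|h| - (|h| - h)], a difference of nonnegative
    functions, and the bound from the integral of [|h|]. The assumption is mere integrability
    because the derivative of an eigenfunction is a priori only in L_2. *)
Lemma cumint_bounded_measurable nu h :
  nu.-integrable I01 (EFin \o h) -> bounded_measurable (cumint nu h).
Proof.
move=> ih.
have ia : nu.-integrable I01 (EFin \o (fun t => `|h t|)) by exact: integrable_norm.
have iN : nu.-integrable I01 (EFin \o (fun t => `|h t| - h t)).
  exact: (integrableB _ ia ih).
split.
  apply: (@eq_measurable_fun _ _ _ _ _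
    (fun x => cumint nu (fun t => `|h t|) x - cumint nu (fun t => `|h t| - h t) x)).
    move=> x; rewrite inE => /mem_itv01 /andP[x0 x1].
    have sx := sub_itv01 x1.
    rewrite {2}/cumint RintegralB//; [|exact: integrableS ia|exact: integrableS ih].
    by rewrite /cumint subKr.
  apply: measurable_funB; apply: cumint_nonneg_measurable => // t _.
  by rewrite subr_ge0 ler_norm.
exists (fine (\int[nu]_(t in I01) `|h t|%:E)) => x /andP[x0 x1].
have sx := sub_itv01 x1.
have ihx : nu.-integrable `[0, x] (EFin \o h) by exact: integrableS ih.
apply: (le_trans (le_normr_Rintegral _ ihx)) => //.
rewrite /Rintegral; apply: fine_le.
- by apply: integrable_fin_num => //; exact: integrableS ia.
- exact: integrable_fin_num.
- apply: ge0_subset_integral => //; exact: (measurable_int nu ia).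
Qed.

Lemma bounded_measurable_cumint nu h : nu I01 = 1%E -> bounded_measurable h ->
  bounded_measurable (cumint nu h).
Proof.
move=> nu1 bh; apply: cumint_bounded_measurable.
exact: bounded_measurable_integrable.
Qed.

(** Dominated convergence with a constant as dominating function. The regularity of the limit is
    included, as this is how the sum of the series is shown to be bounded and measurable. *)
Lemma bounded_cvg_cumint nu (f_ : nat -> R -> R) f (M x : R) : nu I01 = 1%E ->
  x <= 1 ->
  (forall n, bounded_measurable (f_ n)) ->
  (forall n t, 0 <= t <= 1 -> `|f_ n t| <= M) ->
  (forall t, 0 <= t <= 1 -> f_ n t @[n --> \oo] --> f t) ->
  bounded_measurable f /\ cumint nu (f_ n) x @[n --> \oo] --> cumint nu f x.
Proof.
move=> nu1 x1 bf fM fcvg.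
have bmf : bounded_measurable f.
  split.
    apply: (@measurable_fun_cvg _ _ _ I01 f_) => [n|t /mem_itv01]; last exact: fcvg.
    by case: (bf n).
  exists M => t t01; have nc : `|f_ n t| @[n --> \oo] --> `|f t| by apply: cvg_norm; exact: fcvg.
  rewrite -(cvg_lim _ nc)//; apply: limr_le; first by apply/cvg_ex; exists `|f t|.
  by near=> n; exact: fM.
split=> //.
have sx := sub_itv01 x1.
have mfx g : bounded_measurable g -> measurable_fun `[0, x] (EFin \o g).
  by move=> [mg _]; apply/measurable_EFinP; exact: measurable_funS mg.
have [] := @dominated_convergence _ _ _ nu `[0, x]%classic _
  (fun n => EFin \o f_ n) (EFin \o f) (EFin \o cst M).
- by [].
- by move=> n; exact: mfx.
- exact: mfx.
- apply: aeW => t tx; apply: cvg_EFin.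
    by near=> n.
  by apply: fcvg; exact/mem_itv01/sx.
- by apply: bounded_measurable_integrable_itv => //; exact: bounded_measurable_cst.
- by apply: aeW => t tx n /=; rewrite lee_fin fM//; exact/mem_itv01/sx.
move=> ix _ icvg; apply: fine_cvg.
by rewrite fineK//; exact: integrable_fin_num.
Unshelve. all: by end_near. Qed.

End cumulative_integral.

(** * The series of c_L and the Gronwall estimate *)

Section neumann_solution.
Context {R : realType} (mu : {measure set (measurableTypeR R) -> \bar R}).
Hypothesis mu01 : mu `[0, 1]%classic = 1%E.
Implicit Types (K L : R).

Notation leb := (@lebesgue_measure R).

Lemma lebesgue_itv01 : leb `[0, 1]%classic = 1%E.
Proof. by rewrite lebesgue_measure_itv/= lte_fin ltr01 sube0. Qed.
Let leb01 := lebesgue_itv01.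

Lemma bounded_measurable_expR K : bounded_measurable (fun t : R => expR (K * t)).
Proof.
split.
  by apply: measurable_funTS; apply: measurableT_comp => //; exact: mulrl_measurable.
exists (expR `|K|) => x /andP[x0 x1].
rewrite ger0_norm ?expR_ge0// ler_expR (le_trans (ler_norm _))//.
by rewrite normrM (ger0_norm x0) ler_piMr.
Qed.

Lemma cumint_expR K (x : R) : 0 < K -> 0 <= x ->
  cumint leb (fun t => expR (K * t)) x = K^-1 * (expR (K * x) - 1).
Proof.
move=> K0; rewrite le_eqVlt => /predU1P[<-|x0].
  by rewrite /cumint set_itv1 Rintegral_set1 mulr0 expR0 subrr mulr0.
have dF (t : R) : is_derive t 1 (fun t => K^-1 * expR (K * t)) (expR (K * t)).
  apply: is_derive_eq.
  by rewrite /GRing.scale/= mulr1 mulrCA mulVf ?gt_eqF// mulr1.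
have cF t : {for t, continuous (fun t => K^-1 * expR (K * t))}.
  by apply: differentiable_continuous; apply/derivable1_diffP; case: (dF t).
have FTC : (\int[leb]_(t in `[0%R, x]) (expR (K * t))%:E =
    (K^-1 * expR (K * x))%:E - (K^-1 * expR (K * 0))%:E)%E.
  apply: (@continuous_FTC2 _ _ (fun t => K^-1 * expR (K * t))) => //.
  - apply: continuous_subspaceT => t.
    apply: continuous_comp; last exact: continuous_expR.
    by apply: cvgM; [exact: cvg_cst|exact: cvg_id].
  - split => //.
    + exact/cvg_at_right_filter/cF.
    + exact/cvg_at_left_filter/cF.
  - by move=> t _; rewrite derive1E; case: (dF t).
apply: etrans (congr1 fine FTC) _.
by rewrite /= mulr0 expR0 -mulrBr.
Qed.

(** The mu-integral costs only a factor of mass at most 1, because the weight is increasing; the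
    Lebesgue integral of the weight then gains the factor 1/K. *)
Lemma cumint2_le K (N : R) d : 0 < K -> 0 <= N -> bounded_measurable d ->
  (forall t, 0 <= t <= 1 -> `|d t| <= N * expR (K * t)) ->
  forall x, 0 <= x <= 1 ->
  `|cumint leb (cumint mu d) x| <= N / K * expR (K * x).
Proof.
move=> K0 N0 bd dN x /andP[x0 x1].
have bJ := bounded_measurable_cumint mu01 bd.
apply: (le_trans (norm_cumint leb01 x1 bJ)).
apply: (@le_trans _ _ (cumint leb (fun t => N * expR (K * t)) x)).
  apply: le_cumint => //; first exact: bounded_measurable_norm.
    exact/bounded_measurableZ/bounded_measurable_expR.
  move=> t /andP[t0 tx]; have t1 := le_trans tx x1.
  apply: norm_cumint_le => //; first by rewrite t0.
  move=> s /andP[s0 st]; apply: (le_trans (dN _ _)); first by rewrite s0 (le_trans st).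
  by rewrite ler_wpM2l// ler_expR ler_wpM2l// ltW.
rewrite cumintZ//; last exact: bounded_measurable_expR.
rewrite cumint_expR// -mulrA !ler_wpM2l ?invr_ge0 ?(ltW K0)//.
by rewrite gerBl.
Qed.

(* With the weight [expR (2 * K * t)] the Volterra operator below has norm at
   most 1/2, so a bound [N] on the weighted sup norm of [d] improves to
   [delta + N / 2]; iterating leads to [2 * delta]. *)
Lemma gronwall K (delta : R) d : 0 < K -> 0 <= delta -> bounded_measurable d ->
  (forall x, 0 <= x <= 1 ->
    `|d x| <= delta + K * `|cumint leb (cumint mu d) x|) ->
  forall x, 0 <= x <= 1 -> `|d x| <= 2 * delta * expR (2 * K * x).
Proof.
move=> K0 delta0 bd hd.
have [_ [M dM]] := bd.
have M0 : 0 <= M by apply: le_trans (dM 0 _); rewrite ?lexx ?ler01.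
have e1 (x : R) : 0 <= x -> 1 <= expR (2 * K * x).
  by move=> x0; rewrite -expR0 ler_expR !mulr_ge0// ltW.
have step n x : 0 <= x <= 1 ->
    `|d x| <= (2 * delta + geometric M 2^-1 n) * expR (2 * K * x).
  elim: n x => [|n ih] x x01; have /andP[x0 x1] := x01.
    rewrite /geometric/= expr0 mulr1 (le_trans (dM _ x01))//.
    have := e1 _ x0; nra.
  have N0 : 0 <= 2 * delta + geometric M 2^-1 n.
    by rewrite addr_ge0 ?mulr_ge0 ?exprn_ge0 ?invr_ge0.
  have K20 : 0 < 2 * K by rewrite mulr_gt0.
  have := cumint2_le K20 N0 bd ih x01.
  rewrite -(ler_pM2l K0) => h; apply: (le_trans (hd _ x01)).
  apply: (le_trans (lerD (lexx _) h)).
  rewrite /geometric/= exprS.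
  have -> a b : K * (a / (2 * K) * b) = a / 2 * b.
    by field; rewrite gt_eqF.
  have := e1 _ x0; nra.
move=> x x01.
have cv : (2 * delta + geometric M 2^-1 n) * expR (2 * K * x) @[n --> \oo] -->
    (2 * delta + 0) * expR (2 * K * x).
  apply: cvgM; last exact: cvg_cst.
  apply: cvgD; first exact: cvg_cst.
  by apply: cvg_geometric; rewrite ger0_norm ?invr_ge0// invf_lt1// ltr1n.
rewrite addr0 in cv; rewrite -(cvg_lim _ cv)//; apply: limr_ge.
  by apply/cvg_ex; eexists; exact: cv.
by near=> n; exact: step.
Unshelve. all: by end_near. Qed.

(** The series is written in L = z^2, so that negative parameters make sense too; they are needed to
    rule out negative eigenvalues. *)
Definition cos_term L (n : nat) (x : R) : R := (- L) ^+ n * p_fun mu (2 * n) x.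

Definition cos_sum L (x : R) : R := limn (series (fun n => cos_term L n x)).

Lemma c_funE L (x : R) : 0 <= L -> c_fun mu (Num.sqrt L) x = cos_sum L x.
Proof.
move=> L0; rewrite /c_fun /cos_sum; congr (limn (series _)); apply/funext => n.
by rewrite exprM sqr_sqrtr// -exprMn mulN1r.
Qed.

Lemma p_fun_even n : p_fun mu (2 * n.+1) = cumint leb (cumint mu (p_fun mu (2 * n))).
Proof.
by rewrite mulnS /= oddM/=.
Qed.

Lemma bounded_measurable_p_fun n : bounded_measurable (p_fun mu (2 * n)).
Proof.
elim: n => [|n ih]; first exact: bounded_measurable_cst.
rewrite p_fun_even.
by apply: bounded_measurable_cumint => //; exact: bounded_measurable_cumint.
Qed.

Lemma bounded_measurable_cos_term L n : bounded_measurable (cos_term L n).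
Proof. exact/bounded_measurableZ/bounded_measurable_p_fun. Qed.

Lemma cos_termS L n (x : R) : x <= 1 ->
  cos_term L n.+1 x = - L * cumint leb (cumint mu (cos_term L n)) x.
Proof.
move=> x1; rewrite /cos_term p_fun_even exprS -mulrA; congr (_ * _).
rewrite -cumintZ//; last first.
  by apply: bounded_measurable_cumint => //; exact: bounded_measurable_p_fun.
apply: eq_cumint => // t /andP[_ t1].
by rewrite cumintZ//; exact: bounded_measurable_p_fun.
Qed.

(** Relative to the weight [expR (2 * K * x)], each step of the recursion [cos_termS] contracts by
    1/2. This geometric decay gives both convergence and a uniform bound on the partial sums. *)
Lemma norm_cos_term_le K L n (x : R) : 0 < K -> `|L| <= K -> 0 <= x <= 1 ->
  `|cos_term L n x| <= geometric 1 2^-1 n * expR (2 * K * x).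
Proof.
move=> K0 LK; have K20 : 0 < 2 * K by rewrite mulr_gt0.
elim: n x => [|n ih] x x01; have /andP[x0 x1] := x01.
  rewrite /cos_term muln0 /geometric/= !expr0 !mul1r normr1.
  by rewrite -[leLHS]expR0 ler_expR mulr_ge0// ltW.
rewrite cos_termS// normrM normrN.
have g0 : 0 <= geometric (1:R) 2^-1 n by rewrite mulr_ge0 ?exprn_ge0 ?invr_ge0.
have := cumint2_le K20 g0 (bounded_measurable_cos_term L n) ih x01 => h.
apply: (le_trans (ler_pM _ _ LK h)) => //.
rewrite /geometric/= exprS !mul1r.
have -> (a b : R) : K * (a / (2 * K) * b) = 2^-1 * a * b.
  by field; rewrite gt_eqF.
by [].
Qed.

Lemma cos_series_cvg L (x : R) : 0 <= x <= 1 ->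
  series (fun n => cos_term L n x) n @[n --> \oo] --> cos_sum L x.
Proof.
(* Adding 1 keeps the constant positive when L = 0. *)
move=> x01; have K0 : 0 < `|L| + 1 by rewrite ltr_wpDl.
apply: normed_cvg; apply: (@series_le_cvg _ _
    (geometric (expR (2 * (`|L| + 1) * x)) 2^-1)) => //.
- by move=> n; exact: normr_ge0.
- by move=> n; rewrite /geometric/= mulr_ge0 ?expR_ge0 ?exprn_ge0 ?invr_ge0.
- move=> n; apply: (le_trans (norm_cos_term_le n K0 _ x01)); first by rewrite lerDl.
  by rewrite /geometric/= mul1r mulrC.
- by apply: is_cvg_geometric_series; rewrite ger0_norm ?invr_ge0// invf_lt1// ltr1n.
Qed.

Definition cos_part L n (x : R) : R := series (fun k => cos_term L k x) n.

Lemma cos_partS L n (x : R) : cos_part L n.+1 x = cos_part L n x + cos_term L n x.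
Proof. by rewrite /cos_part /series/= big_nat_recr. Qed.

Lemma bounded_measurable_cos_part L n : bounded_measurable (cos_part L n).
Proof.
elim: n => [|n ih].
  rewrite (_ : cos_part L 0 = fun=> 0); first exact: bounded_measurable_cst.
  by apply/funext => x; rewrite /cos_part /series/= big_geq.
rewrite (_ : cos_part L n.+1 = fun x => cos_part L n x + cos_term L n x).
  exact/bounded_measurableD/bounded_measurable_cos_term.
by apply/funext => x; exact: cos_partS.
Qed.

Lemma norm_cos_part_le L n (x : R) : 0 <= x <= 1 ->
  `|cos_part L n x| <= 2 * expR (2 * (`|L| + 1)).
Proof.
move=> x01; have K0 : 0 < `|L| + 1 by rewrite ltr_wpDl.
set E := expR _.
(* The exact geometric partial sum is carried through the induction, as the bare bound 2 would not
   reproduce itself. *)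
suff : `|cos_part L n x| <= (2 - 2 * 2^-1 ^+ n) * E.
  move=> /le_trans; apply; rewrite ler_wpM2r ?expR_ge0// gerBl.
  by rewrite mulr_ge0 ?exprn_ge0 ?invr_ge0.
elim: n => [|n ih].
  by rewrite /cos_part /series/= big_geq// normr0 expr0 mulr1 subrr mul0r.
rewrite cos_partS (le_trans (ler_normD _ _))//.
have h : `|cos_term L n x| <= 2^-1 ^+ n * E.
  apply: (le_trans (norm_cos_term_le n K0 _ x01)); first by rewrite lerDl.
  rewrite /geometric/= mul1r ler_wpM2l ?exprn_ge0 ?invr_ge0// ler_expR.
  by case/andP: x01 => x0 x1; rewrite ler_piMr// mulr_ge0// ltW.
rewrite (le_trans (lerD ih h))// -mulrDl exprS.
by rewrite (_ : 2 - 2 * 2^-1 ^+ n + 2^-1 ^+ n = 2 - 2 * (2^-1 * 2^-1 ^+ n))//; field.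
Qed.

(** The partial sums are the Picard iterates of the Volterra equation that is equivalent to the
    initial value problem. *)
Lemma cos_part_volterra L n (x : R) : x <= 1 ->
  cos_part L n.+1 x = 1 - L * cumint leb (cumint mu (cos_part L n)) x.
Proof.
elim: n x => [|n ih] x x1; rewrite cos_partS.
  rewrite /cos_part /series/= big_geq// /cos_term muln0 expr0 mulr1 add0r.
  rewrite (@eq_cumint _ _ _ (fun=> 0))//; first by rewrite cumint_cst mul0r mulr0 subr0.
  move=> t _; rewrite (_ : (fun x => _) = fun=> 0) ?cumint_cst ?mul0r//.
  by apply/funext => s; rewrite big_geq.
have bP := bounded_measurable_cos_part L n.
have bt := bounded_measurable_cos_term L n.
rewrite ih// cos_termS// mulNr -addrA -opprD -mulrDr; congr (_ - _ * _).
rewrite -cumintD//; try exact: bounded_measurable_cumint.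
apply: eq_cumint => // t /andP[_ t1]; rewrite -cumintD//.
by apply: eq_cumint => // s _; rewrite cos_partS.
Qed.

Lemma bounded_measurable_cos_sum L : bounded_measurable (cos_sum L).
Proof.
have [] // := bounded_cvg_cumint mu01 (lexx 1)
  (bounded_measurable_cos_part L) (norm_cos_part_le L) (@cos_series_cvg L).
Qed.

(** The limit of [cos_part_volterra]: dominated convergence is applied first to the inner integral
    and then to the outer one. *)
Lemma cos_sum_volterra L (x : R) : 0 <= x <= 1 ->
  cos_sum L x = 1 - L * cumint leb (cumint mu (cos_sum L)) x.
Proof.
move=> x01; have /andP[x0 x1] := x01.
have bP n := bounded_measurable_cumint mu01 (bounded_measurable_cos_part L n).
have [M0 PM] : exists M, forall n t, 0 <= t <= 1 ->
    `|cumint mu (cos_part L n) t| <= M.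
  exists (2 * expR (2 * (`|L| + 1))) => n t /andP[t0 t1].
  apply: norm_cumint_le => //; [by rewrite t0|exact: bounded_measurable_cos_part|].
  by move=> s /andP[s0 st]; apply: norm_cos_part_le; rewrite s0 (le_trans st).
have Pc t : 0 <= t <= 1 ->
    cumint mu (cos_part L n) t @[n --> \oo] --> cumint mu (cos_sum L) t.
  move=> /andP[_ t1].
  by have [] := bounded_cvg_cumint mu01 t1
    (bounded_measurable_cos_part L) (norm_cos_part_le L) (@cos_series_cvg L).
have [_ c2] := bounded_cvg_cumint leb01 x1 bP PM Pc.
have c1 : cos_part L n.+1 x @[n --> \oo] --> cos_sum L x.
  by rewrite (cvg_shiftS (fun n => cos_part L n x)); exact: cos_series_cvg.
have c3 : cos_part L n.+1 x @[n --> \oo] -->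
    1 - L * cumint leb (cumint mu (cos_sum L)) x.
  under eq_fun do rewrite cos_part_volterra//.
  by apply: cvgB; [exact: cvg_cst|apply: cvgM; [exact: cvg_cst|exact: c2]].
exact: (cvg_unique _ c1 c3).
Qed.

End neumann_solution.

(** * Uniqueness and the Lagrange identity *)

Section solutions.
Context {R : realType} (mu : probability (measurableTypeR R) R).
Hypothesis mu01 : mu `[0, 1]%classic = 1%E.
Implicit Types (L : R).

Notation leb := (@lebesgue_measure R).
Notation I01 := (`[(0:R), 1]%classic).
Let leb01 : leb `[0, 1]%classic = 1%E := lebesgue_itv01.

(* [v] is the derivative of [u], and the mu-derivative of [v] is [- L * u]. *)
Definition solution L (u0 v0 : R) (u v : R -> R) : Prop :=
  [/\ bounded_measurable u, bounded_measurable v,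
      forall x, 0 <= x <= 1 -> u x = u0 + cumint leb v x &
      forall x, 0 <= x <= 1 -> v x = v0 - L * cumint mu u x].

(** The representative of c_L' dictated by the equation; its value at 1 is the function G(L) of the
    overview. *)
Definition cos_deriv L (x : R) : R := - L * cumint mu (cos_sum mu L) x.

Lemma cos_solution L : solution L 1 0 (cos_sum mu L) (cos_deriv L).
Proof.
have bc := bounded_measurable_cos_sum mu01 L.
have bJ := bounded_measurable_cumint mu01 bc.
split => //; first exact: bounded_measurableZ.
- move=> x x01; rewrite (cos_sum_volterra mu01)//; case/andP: x01 => _ x1.
  by rewrite /cos_deriv cumintZ//; ring.
- by move=> x x01; rewrite /cos_deriv; ring.
Qed.

Lemma solutionZ L (u0 v0 c : R) u v : solution L u0 v0 u v ->
  solution L (c * u0) (c * v0) (fun x => c * u x) (fun x => c * v x).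
Proof.
move=> [bu bv hu hv]; split; try exact: bounded_measurableZ.
- by move=> x x01; rewrite hu// mulrDr cumintZ//; case/andP: x01.
- move=> x x01; rewrite hv// mulrBr cumintZ//; last by case/andP: x01.
  by rewrite mulrCA.
Qed.

(** The difference d of the two solutions satisfies the Volterra equation with parameter L and a
    source term proportional to L - L', so the Gronwall estimate applies. The case L = L' gives
    uniqueness, the general case continuity in the parameter. *)
Lemma solution_dist L L' (u0 v0 M : R) u v u' v' :
  solution L u0 v0 u v -> solution L' u0 v0 u' v' ->
  (forall x, 0 <= x <= 1 -> `|u' x| <= M) ->
  forall x, 0 <= x <= 1 ->
    `|u x - u' x| <= 2 * (`|L - L'| * M) * expR (2 * (`|L| + 1)).
Proof.
move=> [bu bv hu hv] [bu' bv' hu' hv'] u'M x x01.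
have M0 : 0 <= M by apply: le_trans (u'M 0 _); rewrite ?lexx ?ler01.
have K0 : 0 < `|L| + 1 by rewrite ltr_wpDl.
have bd : bounded_measurable (fun x => u x - u' x) by exact: bounded_measurableB.
have Jbm h : bounded_measurable h -> bounded_measurable (cumint mu h).
  exact: bounded_measurable_cumint.
have dE y : 0 <= y <= 1 -> u y - u' y =
    - (L * cumint leb (cumint mu (fun x => u x - u' x)) y) -
    (L - L') * cumint leb (cumint mu u') y.
  move=> /[dup] y01 /andP[y0 y1].
  rewrite hu// hu'// opprD addrACA subrr add0r -cumintB//.
  rewrite -!cumintZ//; try by apply: Jbm.
  rewrite -[X in _ = X - _]mulN1r -cumintZ//; last exact/bounded_measurableZ/Jbm.
  rewrite -cumintB//; last 2 first.
  - exact/bounded_measurableZ/bounded_measurableZ/Jbm.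
  - exact/bounded_measurableZ/Jbm.
  apply: eq_cumint => // t /[dup] t01 /andP[t0 t1].
  by rewrite hv// hv'// cumintB//; ring.
have JM y : 0 <= y <= 1 -> `|cumint leb (cumint mu u') y| <= M.
  move=> /[dup] y01 /andP[y0 y1]; apply: norm_cumint_le => //; first exact: Jbm.
  move=> t /andP[t0 ty]; have t1 := le_trans ty y1.
  apply: norm_cumint_le => //; first by rewrite t0.
  by move=> s /andP[s0 st]; rewrite u'M// s0 (le_trans st).
have hd y : 0 <= y <= 1 -> `|u y - u' y| <= `|L - L'| * M +
    (`|L| + 1) * `|cumint leb (cumint mu (fun x => u x - u' x)) y|.
  move=> y01; rewrite [X in `|X| <= _]dE//.
  rewrite (le_trans (ler_normB _ _))// addrC lerD//.
    by rewrite normrM ler_wpM2l// JM.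
  by rewrite normrN normrM ler_wpM2r// lerDl.
have := gronwall mu01 K0 (mulr_ge0 (normr_ge0 _) M0) bd hd x01.
move/le_trans; apply; rewrite ler_wpM2l ?mulr_ge0// ler_expR.
by case/andP: x01 => x0 x1; rewrite ler_piMr// mulr_ge0// ltW.
Qed.

(** By linearity, [u0] times c_L is a solution with the same initial data, and [solution_dist] with
    equal parameters identifies the two. *)
Lemma solution_unique L (u0 : R) u v : solution L u0 0 u v ->
  forall x, 0 <= x <= 1 -> u x = u0 * cos_sum mu L x /\ v x = u0 * cos_deriv L x.
Proof.
move=> s; have sc := solutionZ u0 (cos_solution L).
rewrite mulr0 mulr1 in sc.
have uE x : 0 <= x <= 1 -> u x = u0 * cos_sum mu L x.
  move=> x01; have [_ [M hM]] := (let: And4 b _ _ _ := sc in b).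
  have := solution_dist s sc hM x01.
  by rewrite subrr normr0 mul0r mulr0 mul0r normr_le0 subr_eq0 => /eqP.
move=> x x01; split; first exact: uE.
case: s => bu bv hu hv; rewrite hv// /cos_deriv.
rewrite (eq_cumint _ _ uE); last by case/andP: x01.
rewrite cumintZ//; [by ring|by case/andP: x01|].
exact: bounded_measurable_cos_sum.
Qed.

(** The product a(s) b(t) on the triangle s <= t of the unit square, extended by 0; the integrand
    for Fubini in the integration by parts. *)
Let tri (a b : R -> R) (st : measurableTypeR R * measurableTypeR R) : R :=
  if st.1 <= st.2 then (a \_ I01) st.1 * (b \_ I01) st.2 else 0.

Let tri_integrable a b : bounded_measurable a -> bounded_measurable b ->
  (mu \x leb)%E.-integrable setT (EFin \o tri a b).
Proof.
move=> [ma [M aM]] [mb [N bN]].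
have mtri : measurable_fun setT (tri a b).
  apply: measurable_fun_ifT.
  - exact: measurable_fun_ler.
  - apply: measurable_funM.
    + by apply: measurableT_comp => //; exact/(measurable_restrictT _ _).1.
    + by apply: measurableT_comp => //; exact/(measurable_restrictT _ _).1.
  - exact: measurable_cst.
have -> : EFin \o tri a b = (EFin \o tri a b) \_ (I01 `*` I01).
  apply/funext => -[s t]; rewrite patchE; case: ifPn => //= stI.
  rewrite /tri/=; case: ifPn => // _; rewrite !patchE.
  case: ifPn => [/set_mem sI|]; last by rewrite mul0r.
  case: ifPn => [/set_mem tI|]; last by rewrite mulr0.
  by move/negP: stI; case; exact/mem_set.
apply/(integrable_mkcond _ _).1; first exact: measurableX.
apply: measurable_bounded_integrable.
- exact: measurableX.
- rewrite (_ : _ (I01 `*` I01) = mu I01 * leb I01)%E; last exact: product_measure1E.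
  by rewrite mu01 leb01 mule1 ltry.
- exact: measurable_funTS.
- exists (M * N); split; first exact: num_real.
  move=> K MNK [s t] [/= /mem_itv01 s01 /mem_itv01 t01].
  rewrite (le_trans _ (ltW MNK))// /tri/= !patchE !mem_set; try exact/mem_itv01.
  case: ifPn => _; first by rewrite normrM ler_pM ?aM ?bN.
  by rewrite normr0 mulr_ge0// (le_trans (normr_ge0 _) (aM _ s01),
    le_trans (normr_ge0 _) (bN _ t01)).
Qed.

(** Fubini on the triangle s <= t under mu times Lebesgue measure: integrating first in t leaves
    a(s) (B(1) - B(s)), integrating first in s leaves b(t) A(t), where A and B are the cumulative
    integrals. *)
Lemma cumint_by_parts a b : bounded_measurable a -> bounded_measurable b ->
  cumint mu a 1 * cumint leb b 1 =
  cumint mu (fun s => a s * cumint leb b s) 1 +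
  cumint leb (fun t => b t * cumint mu a t) 1.
Proof.
move=> ba bb; have := Fubini (tri_integrable ba bb).
have mI x y : measurable (`[x, y]%classic : set (measurableTypeR R)) by [].
have in1 s : (\int[leb]_t (tri a b (s, t))%:E)%E =
    (((fun s => a s * (cumint leb b 1 - cumint leb b s)) \_ I01) s)%:E.
  rewrite patchE; case: ifPn => [/set_mem/mem_itv01/andP[s0 s1]|sI]; last first.
    rewrite integral0_eq// => t _; rewrite /tri/= patchE (negPf sI) mul0r.
    by case: ifP.
  have -> : cumint leb b 1 - cumint leb b s = \int[leb]_(t in `[s, 1]) b t.
    (* The difference is an integral over []s, 1]]; Lebesgue measure does not charge the endpoint
       s. *)
    rewrite /cumint Rintegral_itvB ?bnd_simp// ?Rintegral_itv_obnd_cbnd//.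
    - by apply: bounded_measurable_integrable => // t /=; rewrite !in_itv/= =>
        /andP[/ltW/(le_trans s0)-> ->].
    - exact: bounded_measurable_integrable_itv.
  have sI : `[s, 1]%classic `<=` I01.
    by move=> t /=; rewrite !in_itv/= => /andP[/(le_trans s0)-> ->].
  rewrite -RintegralZl//; last exact: bounded_measurable_integrable.
  rewrite /Rintegral fineK; last first.
    apply: integrable_fin_num => //; apply: bounded_measurable_integrable => //.
    exact: bounded_measurableZ.
  rewrite [RHS]integral_mkcond; apply: eq_integral => t _.
  rewrite /tri/= !patchE mem_set; last exact/mem_itv01/andP.
  case: (boolP (t \in `[s, 1]%classic)) => [/set_mem|].
    rewrite /= in_itv/= => /andP[st t1]; rewrite st mem_set//.
    by apply/mem_itv01; rewrite (le_trans s0 st).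
  move=> /negP tI; case: ifPn => // st; case: ifPn => [/set_mem/mem_itv01/andP[_ t1]|].
    by case: tI; apply/mem_set; rewrite /= in_itv/= st.
  by rewrite mulr0.
have in2 t : (\int[mu]_s (tri a b (s, t))%:E)%E =
    (((fun t => b t * cumint mu a t) \_ I01) t)%:E.
  rewrite patchE; case: ifPn => [/set_mem/mem_itv01/andP[t0 t1]|tI]; last first.
    rewrite integral0_eq// => s _; rewrite /tri/= [(b \_ _) _]patchE (negPf tI) mulr0.
    by case: ifP.
  rewrite -cumintZ// /cumint /Rintegral fineK; last first.
    apply: integrable_fin_num => //; apply: bounded_measurable_integrable_itv => //.
    exact: bounded_measurableZ.
  rewrite [RHS]integral_mkcond; apply: eq_integral => s _.
  rewrite /tri/= !patchE (@mem_set _ I01 t); last exact/mem_itv01/andP.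
  case: (boolP (s \in `[0, t]%classic)) => [/set_mem|].
    rewrite /= in_itv/= => /andP[s0 st]; rewrite st mem_set; first by rewrite (mulrC (a s)).
    by apply/mem_itv01; rewrite s0 (le_trans st).
  move=> /negP sI; case: ifPn => // st; case: ifPn => [/set_mem/mem_itv01/andP[s0 _]|].
    by case: sI; apply/mem_set; rewrite /= in_itv/= st s0.
  by rewrite mul0r.
under eq_integral do rewrite in1.
under [in RHS]eq_integral do rewrite in2.
move=> /(congr1 fine).
rewrite -!/(Rintegral _ _ _) -!Rintegral_mkcond -!/(cumint _ _ 1) => <-.
have bJ := bounded_measurable_cumint leb01 bb.
rewrite -cumintD//; last 2 first.
- exact: bounded_measurableM.
- apply/bounded_measurableM/bounded_measurableB => //.
  exact: bounded_measurable_cst.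
rewrite mulrC -cumintZ//; apply: eq_cumint => // s _.
by rewrite -mulrDr addrC subrK mulrC.
Qed.

(* The boundary terms of the product rule for [u1 * v], as [u1] has
   mu-derivative [- L * u] and [v] has Lebesgue derivative [v1]. *)
Lemma green L L' (u0 w0 v0 z0 : R) u u1 v v1 :
  solution L u0 w0 u u1 -> solution L' v0 z0 v v1 ->
  u1 1 * v 1 - w0 * v0 =
  - L * cumint mu (fun x => u x * v x) 1 + cumint leb (fun x => u1 x * v1 x) 1.
Proof.
move=> [bu bu1 hu hu1] [bv bv1 hv hv1].
have I1 : 0 <= (1:R) <= 1 by rewrite ler01 lexx.
have bw := bounded_measurableZ (- L) bu.
have bJv := bounded_measurable_cumint leb01 bv1.
have bJw := bounded_measurable_cumint mu01 bw.
have := cumint_by_parts bw bv1.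
have -> : cumint leb (fun t => v1 t * cumint mu (fun s => - L * u s) t) 1 =
    cumint leb (fun x => u1 x * v1 x) 1 - w0 * cumint leb v1 1.
  rewrite -cumintZ// -cumintB//; [|exact: bounded_measurableM|exact: bounded_measurableZ].
  apply: eq_cumint => // t t01; rewrite hu1// cumintZ//; last by case/andP: t01.
  by ring.
have -> : cumint mu (fun s => - L * u s * cumint leb v1 s) 1 =
    - L * cumint mu (fun x => u x * v x) 1 + L * v0 * cumint mu u 1.
  rewrite -!cumintZ//; last exact: bounded_measurableM.
  rewrite -cumintD//; [|exact/bounded_measurableZ/bounded_measurableM|exact: bounded_measurableZ].
  by apply: eq_cumint => // t t01; rewrite hv//; ring.
by rewrite hu1// hv// cumintZ// => E; nra.
Qed.

(** Subtracting [green] with the roles exchanged cancels the symmetric integral of [u1 * v1]. *)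
Lemma lagrange L L' (u0 w0 v0 z0 : R) u u1 v v1 :
  solution L u0 w0 u u1 -> solution L' v0 z0 v v1 ->
  u1 1 * v 1 - v1 1 * u 1 - (w0 * v0 - z0 * u0) =
  (L' - L) * cumint mu (fun x => u x * v x) 1.
Proof.
move=> su sv; have := green su sv; have := green sv su.
have -> : (fun x => v x * u x) = (fun x => u x * v x).
  by apply/funext => x; rewrite mulrC.
have -> : (fun x => v1 x * u1 x) = (fun x => u1 x * v1 x).
  by apply/funext => x; rewrite mulrC.
by move=> E1 E2; nra.
Qed.

End solutions.

(** * Eigenvalues as zeros of c_L'(1) *)

Section neumann_eigenvalues.
Context {R : realType} (mu : probability (measurableTypeR R) R).
Hypothesis mu01 : mu `[0, 1]%classic = 1%E.
Hypothesis mu0 : mu [set 0] = 0%E.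
Implicit Types (L : R).

Notation leb := (@lebesgue_measure R).
Notation I01 := (`[(0:R), 1]%classic).
Let leb01 : leb `[0, 1]%classic = 1%E := lebesgue_itv01.
Let in1 : 0 <= (1:R) <= 1. Proof. by rewrite lexx ler01. Qed.

Lemma Lnorm2_cumint (nu : {measure set (measurableTypeR R) -> \bar R}) h :
  nu I01 = 1%E -> bounded_measurable h ->
  'N[nu]_2%:E[EFin \o (h \_ I01)]%E = (Num.sqrt (cumint nu (fun x => h x ^+ 2) 1))%:E.
Proof.
move=> nu1 bh; have b2 := bounded_measurableM bh bh.
rewrite unlock.
have -> : (\int[nu]_x `|(EFin \o h \_ I01) x| `^ 2 =
    (cumint nu (fun x => h x ^+ 2)%R 1)%:E)%E.
  rewrite /cumint /Rintegral fineK; last first.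
    apply: integrable_fin_num => //.
    exact: (bounded_measurable_integrable_itv nu1 b2).
  rewrite [RHS]integral_mkcond; apply: eq_integral => x _ /=.
  rewrite powR_mulrn// patchE [in RHS]patchE; case: ifPn => // _.
    by rewrite real_normK ?num_real.
  by rewrite normr0 expr0n.
by rewrite poweR_EFin powR12_sqrt// cumint_ge0// => t _; rewrite sqr_ge0.
Qed.

Lemma bounded_measurable_Lfun2 (nu : {measure set (measurableTypeR R) -> \bar R}) h :
  nu I01 = 1%E -> bounded_measurable h -> h \_ I01 \in Lfun nu 2%:E.
Proof.
move=> nu1 bh; rewrite inE; apply/andP; split; rewrite inE/=.
  by apply/(measurable_restrictT _ _).1 => //; case: bh.
by rewrite /finite_norm Lnorm2_cumint// ltry.
Qed.

(** On a finite measure space L_2 embeds in L_1, by |h| <= 1 + h^2. *)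
Lemma Lfun2_integrable_itv (nu : {measure set (measurableTypeR R) -> \bar R}) h :
  nu I01 = 1%E -> h \_ I01 \in Lfun nu 2%:E -> nu.-integrable I01 (EFin \o h).
Proof.
move=> nu1 hL; have i2 := Lfun2_integrable_sqr hL.
move: hL; rewrite inE => /andP[+ _]; rewrite inE/= => mh.
have ic : nu.-integrable I01 (EFin \o (fun=> 1 : R)).
  exact/(bounded_measurable_integrable_itv nu1)/lexx/bounded_measurable_cst.
have i2' : nu.-integrable I01 (EFin \o (fun x => (h \_ I01) x ^+ 2)).
  exact: integrableS i2.
apply: (le_integrable _ _ _ (integrableD _ ic i2')) => //.
- by apply/measurable_EFinP; apply/(measurable_restrictT _ _).2.
- move=> x xI /=; rewrite lee_fin patchE mem_set//.
  rewrite [leRHS]ger0_norm ?addr_ge0 ?sqr_ge0//.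
  rewrite -(real_normK (num_real (h x))); have := normr_ge0 (h x); nra.
Qed.

(** For L <= 0 every term of the series is nonnegative, so the Volterra equation adds a nonnegative
    quantity to 1. *)
Lemma cos_sum_ge1 L (x : R) : L <= 0 -> 0 <= x <= 1 -> 1 <= cos_sum mu L x.
Proof.
move=> L0 x01; rewrite (cos_sum_volterra mu01)//.
have p0 n y : 0 <= p_fun mu (2 * n) y.
  elim: n y => [|n ih] y; first by rewrite muln0 ler01.
  by rewrite p_fun_even; apply: cumint_ge0 => t _; exact: cumint_ge0.
rewrite -mulNr lerDl mulr_ge0 ?oppr_ge0//.
apply: cumint_ge0 => t /andP[t0' tx]; apply: cumint_ge0 => s /andP[s0 st].
have s01 : 0 <= s <= 1.
  by rewrite s0 (le_trans st)// (le_trans tx)//; case/andP: x01.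
have c := @cos_series_cvg _ _ mu01 L _ s01.
rewrite -(cvg_lim _ c)//; apply: limr_ge; first by apply/cvg_ex; eexists; exact: c.
by apply: nearW => n; apply: sumr_ge0 => k _; rewrite mulr_ge0 ?exprn_ge0 ?oppr_ge0.
Qed.

Lemma cos_deriv_gt0 L : L < 0 -> 0 < cos_deriv mu L 1.
Proof.
move=> L0; rewrite /cos_deriv mulr_gt0 ?oppr_gt0//.
apply: (@lt_le_trans _ _ (cumint mu (fun=> 1) 1)).
  by rewrite cumint_cst1.
apply: le_cumint => //; [exact: bounded_measurable_cst|exact: bounded_measurable_cos_sum|].
by move=> t t01; rewrite cos_sum_ge1// ltW.
Qed.

(** An eigenfunction f turns out to be bounded and measurable, with zero initial slope, so it equals
    f(0) c_L with f(0) nonzero, and its second boundary condition reads G(L) = 0. Conversely c_L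
    itself is an eigenfunction. *)
Lemma neumann_eigenvalueP L : neumann_eigenvalue mu L <-> cos_deriv mu L 1 = 0.
Proof.
have bN f : bounded_measurable f -> bounded_measurable (fun x => - L * f x).
  exact: bounded_measurableZ.
split.
  move=> [f [g [[x x01 fx] [[gL fE] _] [_ gE] g0 g1]]].
  have bf : bounded_measurable f.
    apply: (@eq_bounded_measurable _ (fun x => f 0 + cumint leb g x)).
      by move=> y y01; rewrite [RHS]fE.
    apply: bounded_measurableD; first exact: bounded_measurable_cst.
    exact/cumint_bounded_measurable/(Lfun2_integrable_itv leb01).
  have gE' y : 0 <= y <= 1 -> g y = 0 - L * cumint mu f y.
    move=> y01; rewrite gE// g0 -/(cumint mu _ y) cumintZ//; last by case/andP: y01.
    by ring.
  have bg : bounded_measurable g.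
    apply: (@eq_bounded_measurable _ (fun x => - L * cumint mu f x)).
      by move=> y y01; rewrite [RHS]gE'//; ring.
    exact/bN/bounded_measurable_cumint.
  have s : solution mu L (f 0) 0 f g by split.
  have [_] := solution_unique mu01 s in1; rewrite g1 => /esym/eqP.
  rewrite mulf_eq0 => /orP[/eqP f0|/eqP//].
  have [fx0 _] := solution_unique mu01 s x01.
  by move: fx; rewrite fx0 f0 mul0r eqxx.
move=> G0; have [bc bd hc hd] := cos_solution mu01 L.
have c0 : cos_sum mu L 0 = 1.
  by rewrite hc ?lexx ?ler01// /cumint set_itv1 Rintegral_set1 addr0.
(* Here [mu [set 0] = 0] enters, the integral being over the closed interval from 0 to 0. *)
have d0 : cos_deriv mu L 0 = 0.
  by rewrite /cos_deriv cumint_at0// mulr0.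
have dE : is_measure_derivative mu (cos_deriv mu L) (fun x => - L * cos_sum mu L x).
  split; first exact/bounded_measurable_Lfun2/bN.
  move=> x x01; rewrite d0 add0r -/(cumint mu _ x) cumintZ//.
  by case/andP: x01.
exists (cos_sum mu L), (cos_deriv mu L); split => //.
- by exists 0; rewrite ?c0 ?oner_eq0 ?lexx ?ler01.
- split; last by eexists; exact: dE.
  split; first exact: bounded_measurable_Lfun2.
  by move=> x x01; rewrite hc// c0.
Qed.

Lemma continuous_cos_pairing h : bounded_measurable h ->
  continuous (fun L => cumint mu (fun x => cos_sum mu L x * h x) 1).
Proof.
move=> bh L; have bc := bounded_measurable_cos_sum mu01.
have [[_ [M cM]] [_ [N hN]]] := (bc L, bh).
have N0 : 0 <= N := le_trans (normr_ge0 _) (hN _ in1).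
have M0 : 0 <= M := le_trans (normr_ge0 _) (cM _ in1).
(* The Lipschitz constant from [solution_dist]: [M] bounds c_L, [N] bounds [h], and |L'| + 1 <= |L|
   + 2 when |L - L'| < 1. *)
pose C := 2 * M * expR (2 * (`|L| + 2)) * N.
have C0 : 0 <= C by rewrite !mulr_ge0// expR_ge0.
have bound L' : `|L - L'| < 1 ->
    `|cumint mu (fun x => cos_sum mu L x * h x) 1 -
      cumint mu (fun x => cos_sum mu L' x * h x) 1| <= C * `|L - L'|.
  move=> L1; rewrite -cumintB//; try exact: bounded_measurableM.
  apply: norm_cumint_le => //; first by apply: bounded_measurableB; exact: bounded_measurableM.
  move=> t t01; rewrite -mulrBl normrM distrC.
  have := solution_dist mu01 (cos_solution mu01 L') (cos_solution mu01 L) cM t01.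
  rewrite [`|L' - L|]distrC => h1.
  have h2 : `|cos_sum mu L' t - cos_sum mu L t| <=
      2 * (`|L - L'| * M) * expR (2 * (`|L| + 2)).
    apply: (le_trans h1); rewrite ler_wpM2l ?mulr_ge0// ler_expR ler_wpM2l//.
    have : `|L'| <= `|L - L'| + `|L| by have := ler_normB L (L - L'); rewrite subKr addrC.
    lra.
  apply: (le_trans (ler_pM _ _ h2 (hN _ t01))) => //.
  by rewrite /C le_eqVlt; apply/orP; left; apply/eqP; ring.
apply/cvgrPdist_lt => e e0; near=> L'.
apply: (@le_lt_trans _ _ (C * `|L - L'|)).
  by apply: bound; near: L'; exact: (@cvgr_dist_lt _ _ _ _ _ id).
(* Since [C] may vanish, the division is by [C + 1]. *)
have : `|L - L'| < e / (C + 1).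
  by near: L'; apply: (@cvgr_dist_lt _ _ _ _ _ id) => //; rewrite divr_gt0// ltr_wpDl.
rewrite ltr_pdivlMr ?ltr_wpDl// => h1.
by have := normr_ge0 (L - L'); nra.
Unshelve. all: by end_near. Qed.

Lemma continuous_cos_deriv1 : continuous (fun L => cos_deriv mu L 1).
Proof.
have h := continuous_cos_pairing (bounded_measurable_cst 1).
have -> : (fun L => cos_deriv mu L 1) =
    (fun L => - L * cumint mu (fun x => cos_sum mu L x * 1) 1).
  apply/funext => L; congr (_ * _); congr (cumint _ _ _).
  by apply/funext => x; rewrite mulr1.
by move=> L; apply: cvgM; [apply: cvgN; exact: cvg_id|exact: h].
Qed.

(** If the norm vanished, so would every integral of c_L over [0,x]; the Volterra equation would
    then give c_L = 1, whose norm is 1. *)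
Lemma cos_norm_gt0 L : 0 < cumint mu (fun x => cos_sum mu L x ^+ 2) 1.
Proof.
rewrite lt_neqAle cumint_ge0 ?andbT; last by move=> t _; exact: sqr_ge0.
apply/eqP => /esym c0.
have bc := bounded_measurable_cos_sum mu01 L.
have b2 := bounded_measurableM bc bc.
have J0 x : 0 <= x <= 1 -> cumint mu (cos_sum mu L) x = 0.
  move=> /andP[x0 x1].
  have c0x : cumint mu (fun x => cos_sum mu L x ^+ 2) x = 0.
    apply/eqP; rewrite eq_le [X in _ && X]cumint_ge0 ?andbT; last by move=> t _; exact: sqr_ge0.
    rewrite -c0 /cumint /Rintegral; apply: fine_le.
    - by apply: integrable_fin_num => //; exact: (bounded_measurable_integrable_itv mu01 b2).
    - by apply: integrable_fin_num => //; exact: (bounded_measurable_integrable_itv mu01 b2).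
    apply: ge0_subset_integral => //.
    - by apply/measurable_EFinP; case: b2.
    - by move=> t _; rewrite lee_fin sqr_ge0.
    - exact: sub_itv01.
  apply/eqP; rewrite -normr_le0; apply/ler_addgt0Pl => e e0; rewrite addr0.
  apply: (le_trans (norm_cumint mu01 x1 bc)).
  (* A substitute for Cauchy-Schwarz: |c| <= e + c^2 / e for every e > 0, and the integral of c^2 is
     zero. *)
  have bb : bounded_measurable (fun t => e + e^-1 * (cos_sum mu L t * cos_sum mu L t)).
    apply: bounded_measurableD; first exact: bounded_measurable_cst.
    exact: bounded_measurableZ.
  apply: (@le_trans _ _ (cumint mu (fun t => e + e^-1 * (cos_sum mu L t * cos_sum mu L t)) x)).
    apply: le_cumint => //; first exact: bounded_measurable_norm.
    move=> t _; rewrite -[X in _ * X]expr2 -(real_normK (num_real (cos_sum mu L t))).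
    have := normr_ge0 (cos_sum mu L t); move: `|_| => a a0.
    rewrite -(ler_pM2l e0) mulrDr mulrA mulfV ?gt_eqF// mul1r; nra.
  rewrite cumintD//; [|exact: bounded_measurable_cst|exact: bounded_measurableZ].
  rewrite cumintZ// (c0x : cumint mu (fun t => _ * _) x = 0) mulr0 addr0 cumint_cst.
  by rewrite ler_piMr ?(ltW e0)//; case/andP: (fine_itv01_le1 mu01 x1).
have c1 x : 0 <= x <= 1 -> cos_sum mu L x = 1.
  move=> /[dup] x01 /andP[x0 x1]; rewrite (cos_sum_volterra mu01)//.
  rewrite (@eq_cumint _ _ _ (fun=> 0))// ?cumint_cst ?mul0r ?mulr0 ?subr0//.
move: c0; rewrite (@eq_cumint _ _ _ (fun=> 1))//.
  by rewrite cumint_cst1// => /eqP; rewrite oner_eq0.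
by move=> t t01; rewrite c1// expr1n.
Qed.

Lemma cos_deriv_cross L L' : cos_deriv mu L' 1 = 0 ->
  cos_deriv mu L 1 * cos_sum mu L' 1 =
  (L' - L) * cumint mu (fun x => cos_sum mu L x * cos_sum mu L' x) 1.
Proof.
move=> G0; have := lagrange mu01 (cos_solution mu01 L) (cos_solution mu01 L').
by rewrite G0 => <-; ring.
Qed.

(** At L' = L the pairing is the squared norm, so it stays positive nearby. Near an eigenvalue,
    [cos_deriv_cross] then yields the sign of G. *)
Lemma cos_pairing_gt0_near L : \forall L' \near L,
  0 < cumint mu (fun x => cos_sum mu L' x * cos_sum mu L x) 1.
Proof.
have h := @continuous_cos_pairing _ (bounded_measurable_cos_sum mu01 L) L.
exact: (cvgr_gt _ h 0 (cos_norm_gt0 L)).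
Qed.

Let min0max (x y : R) : x * y <= 0 -> Num.min x y <= 0 <= Num.max x y.
Proof.
rewrite ge_min le_max => xy; case: (leP x 0) => x0 /=; last by rewrite (ltW x0) andbT; nra.
by case: (leP 0 y) => y0; rewrite ?orbT//= orbF; nra.
Qed.

Let mul_lt0 (x y A B : R) : x * A < 0 -> 0 < y * B -> 0 < x * y -> A * B < 0.
Proof. nra. Qed.

(** Just to the right of L, G has the sign of -c_L(1); just to the left of L' it has the sign of
    c_L'(1), where L' is the second parameter. As G has no zero in between, these signs agree. *)
Lemma consecutive_zeros_sign L L' : L < L' ->
  cos_deriv mu L 1 = 0 -> cos_deriv mu L' 1 = 0 ->
  (forall K, L < K < L' -> cos_deriv mu K 1 != 0) ->
  cos_sum mu L 1 * cos_sum mu L' 1 < 0.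
Proof.
move=> LL' G0 G0' Gn0.
(* The midpoint separates the two sample points, ensuring a < b. *)
have [a [La aL' aG]] : exists a,
    [/\ L < a, a < (L + L') / 2 & cos_deriv mu a 1 * cos_sum mu L 1 < 0].
  near L^'+ => a; exists a; split.
  - by near: a; exact: nbhs_right_gt.
  - by near: a; apply: nbhs_right_lt; rewrite midf_lt.
  - rewrite cos_deriv_cross// pmulr_llt0; last first.
      by near: a; apply: cvg_within; exact: cos_pairing_gt0_near.
    by rewrite subr_lt0; near: a; exact: nbhs_right_gt.
have [b [bL bL' bG]] : exists b,
    [/\ (L + L') / 2 < b, b < L' & 0 < cos_deriv mu b 1 * cos_sum mu L' 1].
  near L'^'- => b; exists b; split.
  - by near: b; apply: nbhs_left_gt; rewrite midf_lt.
  - by near: b; exact: nbhs_left_lt.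
  - rewrite cos_deriv_cross// pmulr_lgt0; last first.
      by near: b; apply: cvg_within; exact: cos_pairing_gt0_near.
    by rewrite subr_gt0; near: b; exact: nbhs_left_lt.
have ab := lt_trans aL' bL.
have GG : 0 < cos_deriv mu a 1 * cos_deriv mu b 1.
  rewrite ltNge; apply/negP => neg.
  have [||c] := @IVT _ (fun K => cos_deriv mu K 1) a b 0 (ltW ab).
  - exact/continuous_subspaceT/continuous_cos_deriv1.
  - exact: min0max.
  - rewrite in_itv/= => /andP[ac cb] /eqP; apply/negP/Gn0.
    by rewrite (lt_le_trans La ac) (le_lt_trans cb bL').
exact: mul_lt0 aG bG GG.
Unshelve. all: by end_near. Qed.

End neumann_eigenvalues.

(** * Affine substitution *)

Section affine_substitution.
Context {R : realType}.
Implicit Types (nu : {measure set (measurableTypeR R) -> \bar R}) (h : R -> R).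

Notation I01 := (`[(0:R), 1]%classic).

(* [nu] restricted to the interval ]b, b + r] is [w] times the image of [nu]
   under [t |-> r * t + b]. *)
Definition scales_by nu (r b w : R) : Prop :=
  forall A : set (measurableTypeR R), measurable A -> A `<=` `]b, b + r]%classic ->
    nu A = (w%:E * nu ((fun t : R => (r * t + b)%R) @^-1` A))%E.

Lemma measurable_affine (r b : R) :
  measurable_fun [set: measurableTypeR R] (fun t : measurableTypeR R => r * t + b).
Proof. by apply: measurable_funD => //; exact: measurable_funM. Qed.

Lemma bounded_measurable_affine (r b : R) h : 0 < r -> 0 <= b -> b + r <= 1 ->
  bounded_measurable h -> bounded_measurable (fun x => h (r * x + b)).
Proof.
move=> r0 b0 br [mh [M hM]].
have aff x : 0 <= x <= 1 -> 0 <= r * x + b <= 1.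
  by move=> /andP[x0 x1]; apply/andP; split; nra.
split; last by exists M => x /aff/hM.
apply: (measurable_comp _ _ mh) => //.
- by move=> _ [x /mem_itv01/aff xI <-]; exact/mem_itv01.
- exact: measurable_funTS (@measurable_affine r b).
Qed.

(** Passes to the half-open intervals used in [scales_by], for which adjacent cells do not
    overlap. *)
Lemma cumint_oc nu h (x : R) : nu I01 = 1%E -> nu [set 0] = 0%E -> x <= 1 ->
  bounded_measurable h -> cumint nu h x = \int[nu]_(t in `]0, x]) h t.
Proof.
move=> nu1 nu0 x1 bh; rewrite /cumint /Rintegral.
rewrite (@negligible_integral _ _ _ nu _ ([set 0] : set (measurableTypeR R)))//.
  congr (fine (integral _ _ _)); apply/seteqP; split => t /=.
    by rewrite !in_itv/= => -[/andP[t0 tx] /eqP tn0]; rewrite lt_neqAle eq_sym tn0 t0.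
  by rewrite !in_itv/= => /andP[t0 tx]; rewrite (ltW t0) tx; split => //; apply/eqP; rewrite gt_eqF.
exact: bounded_measurable_integrable_itv.
Qed.

Lemma cumint_split nu h (x y : R) : nu I01 = 1%E -> 0 <= x <= y -> y <= 1 ->
  bounded_measurable h -> cumint nu h y = cumint nu h x + \int[nu]_(t in `]x, y]) h t.
Proof.
move=> nu1 /andP[x0 xy] y1 bh; rewrite /cumint.
have -> : `[0, y]%classic = `[0, x]%classic `|` `]x, y]%classic.
  apply/seteqP; split => t /=; rewrite !in_itv/=.
    by move=> /andP[t0 ty]; case: (leP t x) => tx; [left|right]; rewrite ?t0 ?tx.
  by move=> [/andP[-> /le_trans->]//|/andP[/ltW/(le_trans x0)-> ->]].
rewrite Rintegral_setU//.
- apply: bounded_measurable_integrable => //; first exact: measurableU.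
  move=> t /=; rewrite !in_itv/=.
  move=> [/andP[-> tx]|/andP[/ltW/(le_trans x0)-> ty]] /=.
    by rewrite (le_trans tx)// (le_trans xy).
  exact: le_trans y1.
- apply/disj_setPS => t [] /=; rewrite !in_itv/= => /andP[_ tx] /andP[xt _].
  by move: (le_lt_trans tx xt); rewrite ltxx.
Qed.

Lemma cumint_gap nu h (x y : R) : nu I01 = 1%E -> 0 <= x <= y -> y <= 1 ->
  bounded_measurable h -> nu `]x, y]%classic = 0%E -> cumint nu h y = cumint nu h x.
Proof.
move=> nu1 xy y1 bh nuxy; rewrite (cumint_split nu1 xy)// /Rintegral.
rewrite null_set_integral ?addr0//; apply/measurable_EFinP.
apply: measurable_funS (proj1 bh) => // t /=; rewrite !in_itv/=.
case/andP: xy => x0 _ /andP[/ltW/(le_trans x0)-> ty]; exact: le_trans y1.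
Qed.

(** On the cell, [nu] coincides with [w] times an image measure, so this is a change of
    variables. *)
Lemma cumint_affine_ge0 nu (r b w : R) h (x : R) : 0 < r -> 0 <= b -> b + r <= 1 ->
  0 <= w -> nu I01 = 1%E -> scales_by nu r b w -> 0 <= x <= 1 ->
  bounded_measurable h -> (forall t, 0 <= t <= 1 -> 0 <= h t) ->
  \int[nu]_(t in `]b, b + r * x]) h t = w * \int[nu]_(t in `]0, x]) h (r * t + b).
Proof.
move=> r0 b0 br w0 nu1 nuS /andP[x0 x1] bh h0.
have mS := @measurable_affine r b.
have Dsub : `]b, b + r * x]%classic `<=` I01.
  move=> t /=; rewrite !in_itv/= => /andP[/ltW/(le_trans b0)-> tx] /=.
  by apply: (le_trans tx); nra.
have mh : measurable_fun `]b, b + r * x] (EFin \o h).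
  by apply/measurable_EFinP; exact: measurable_funS (proj1 bh).
pose k : {nonneg R} := NngNum w0.
rewrite /Rintegral.
rewrite (eq_measure_integral (mscale k (pushforward nu
  (fun t : measurableTypeR R => r * t + b : measurableTypeR R)))).
  rewrite ge0_integral_mscale//; last first.
    by move=> t /Dsub/mem_itv01/h0; rewrite lee_fin.
  rewrite ge0_integral_pushforward//; last first.
    by move=> t /set_mem/Dsub/mem_itv01/h0; rewrite lee_fin.
  have -> : (fun t : R => r * t + b) @^-1` `]b, b + r * x]%classic = `]0, x]%classic.
    apply/seteqP; split => t /=; rewrite !in_itv/=.
      by move=> /andP[? ?]; apply/andP; split; nra.
    by move=> /andP[? ?]; apply/andP; split; nra.
  rewrite fineM//; apply: integrable_fin_num => //.
  apply: (bounded_measurable_integrable nu1 (bounded_measurable_affine r0 b0 br bh)) => //.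
  by move=> t /=; rewrite !in_itv/= => /andP[/ltW-> /le_trans->].
move=> A mA AD; rewrite nuS//.
move=> t /AD /=; rewrite !in_itv/= => /andP[-> tx] /=.
by apply: (le_trans tx); nra.
Qed.

Lemma cumint_affine nu (r b w : R) h (x : R) : 0 < r -> 0 <= b -> b + r <= 1 ->
  0 <= w -> nu I01 = 1%E -> nu [set 0] = 0%E -> scales_by nu r b w ->
  0 <= x <= 1 -> bounded_measurable h ->
  cumint nu h (r * x + b) = cumint nu h b + w * cumint nu (fun t => h (r * t + b)) x.
Proof.
move=> r0 b0 br w0 nu1 nu0 nuS x01 bh; have /andP[x0 x1] := x01.
have y1 : b + r * x <= 1 by nra.
have bhS := bounded_measurable_affine r0 b0 br bh.
have nneg g : bounded_measurable g -> (forall t, 0 <= t <= 1 -> 0 <= g t) ->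
    cumint nu g (b + r * x) = cumint nu g b + w * cumint nu (fun t => g (r * t + b)) x.
  move=> bg g0; rewrite (@cumint_split _ _ b)//; last by rewrite b0 lerDl mulr_ge0// ltW.
  rewrite (cumint_affine_ge0 r0 b0 br w0)// -cumint_oc//.
  exact: bounded_measurable_affine.
(* The nonnegative case is applied to [h + M] and to the constant [M], and the results are
   subtracted. *)
have [_ [M hM]] := bh.
have bM : bounded_measurable (fun=> M) by exact: bounded_measurable_cst.
have := nneg _ (bounded_measurableD bh bM).
have hM0 t : 0 <= t <= 1 -> 0 <= h t + M.
  by move=> /hM; rewrite ler_norml => /andP[+ _]; rewrite -subr_ge0 opprK.
have M0 (t : R) : 0 <= t <= 1 -> 0 <= M.
  by move=> t01; rewrite (le_trans (normr_ge0 _) (hM _ t01)).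
move=> /(_ hM0); rewrite !cumintD//; last by rewrite (le_trans _ br)// lerDl ltW.
have := nneg _ bM M0 => -> E.
rewrite [r * x + b]addrC; move: E.
set a := cumint _ _ _; set c := cumint _ _ _; set d := cumint _ _ _.
set e := cumint _ _ _; set f := cumint _ _ _ => E.
by lra.
Qed.

(* The factor [r] in the derivative and [w] in the mu-derivative turn the
   spectral parameter [L] into [r * w * L]. *)
Lemma solution_affine (mu : probability (measurableTypeR R) R)
    (r b w L u0 v0 : R) u v :
  0 < r -> 0 <= b -> b + r <= 1 -> 0 <= w -> mu I01 = 1%E -> mu [set 0] = 0%E ->
  scales_by mu r b w -> scales_by lebesgue_measure r b r ->
  solution mu L u0 v0 u v ->
  solution mu (r * w * L) (u b) (r * v b)
    (fun x => u (r * x + b)) (fun x => r * v (r * x + b)).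
Proof.
move=> r0 b0 br w0 mu1 mu0 muS lebS [bu bv hu hv].
have aff x : 0 <= x <= 1 -> 0 <= r * x + b <= 1.
  by move=> /andP[x0 x1]; apply/andP; split; nra.
have b01 : 0 <= b <= 1 by rewrite b0 (le_trans _ br)// lerDl ltW.
have buS := bounded_measurable_affine r0 b0 br bu.
have bvS := bounded_measurable_affine r0 b0 br bv.
have leb0 : @lebesgue_measure R [set 0] = 0%E by rewrite lebesgue_measure_set1.
split => //; first exact: bounded_measurableZ.
- move=> x x01; have /andP[x0 x1] := x01; rewrite hu ?aff// [in RHS]hu//.
  rewrite (cumint_affine r0 b0 br (ltW r0) lebesgue_itv01 leb0 lebS x01 bv).
  by rewrite cumintZ ?addrA//; exact: lebesgue_itv01.
- move=> x x01; rewrite hv ?aff// [in RHS]hv//.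
  by rewrite (cumint_affine r0 b0 br w0 mu1 mu0 muS x01 bu); ring.
Qed.

(** By uniqueness of Lebesgue measure it suffices to compare the two measures on half-open
    intervals. *)
Lemma lebesgue_scales_by (r b : R) : 0 < r -> scales_by lebesgue_measure r b r.
Proof.
move=> r0 A mA _; pose k : {nonneg R} := NngNum (ltW r0).
have mS := @measurable_affine r b.
apply: (@lebesgue_measure_unique _ (mscale k (pushforward lebesgue_measure
  (fun t : measurableTypeR R => r * t + b : measurableTypeR R)))) => //.
move=> _ [[x y] /= xy <-].
rewrite /mscale/= /pushforward.
have -> : (fun t : R => r * t + b) @^-1` `]x, y]%classic =
    `]((x - b) / r), ((y - b) / r)]%classic.
  apply/seteqP; split => t /=; rewrite !in_itv/= ltr_pdivrMr// ler_pdivlMr//.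
    by move=> /andP[? ?]; apply/andP; split; nra.
  by move=> /andP[? ?]; apply/andP; split; nra.
rewrite !lebesgue_measure_itv/= !lte_fin ltr_pM2r ?invr_gt0// ltrD2r.
case: ifPn => _; last by rewrite mule0.
by rewrite -!EFinD -EFinM; congr EFin; field; rewrite gt_eqF.
Qed.

End affine_substitution.

(** * Solutions for a self-similar measure *)

Section self_similarity.
Context {R : realType} (r1 r2 m1 m2 : R) (mu : probability (measurableTypeR R) R).
Hypotheses (hr1 : 0 < r1) (hr2 : 0 < r2) (hm1 : 0 < m1) (hm2 : 0 < m2).
Hypotheses (hr : r1 + r2 <= 1) (hm : m1 + m2 = 1) (hrm : r1 * m1 = r2 * m2).
Hypothesis hmu : self_similar_measure r1 r2 m1 m2 mu.

Notation I01 := (`[(0:R), 1]%classic).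
Notation leb := (@lebesgue_measure R).
Let leb01 : leb I01 = 1%E := lebesgue_itv01.

Let mu01 : mu I01 = 1%E := proj1 hmu.

Let in1 : 0 <= (1:R) <= 1. Proof. by rewrite lexx ler01. Qed.

Let muE (A : set (measurableTypeR R)) : measurable A ->
  mu A = (m1%:E * mu ((fun t : R => (r1 * t + 0)%R) @^-1` A) +
          m2%:E * mu ((fun t : R => (r2 * t + (1 - r2))%R) @^-1` A))%E.
Proof.
move=> mA; rewrite (proj2 hmu _ mA); congr (_ * mu _ + _ * mu _)%E.
  by apply/seteqP; split => t /=; rewrite addr0.
by apply/seteqP; split => t /=; rewrite addrA.
Qed.

Let mpre (r b : R) (A : set (measurableTypeR R)) : measurable A ->
  measurable ((fun t : measurableTypeR R => r * t + b : measurableTypeR R) @^-1` A).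
Proof. by move=> mA; rewrite -[X in measurable X]setTI; exact: measurable_affine. Qed.

Lemma self_similar_null (A : set (measurableTypeR R)) : measurable A ->
  A `<=` ~` I01 -> mu A = 0%E.
Proof.
move=> mA AI; apply/eqP; rewrite eq_le measure_ge0 andbT.
apply: (@le_trans _ _ (mu (~` I01))); first by
  apply: le_measure; rewrite ?inE//; exact: measurableC.
by rewrite probability_setC// mu01 subee.
Qed.

(** The preimage of 0 under S_2 lies outside [0,1], so self-similarity reads mu{0} = m1 mu{0} with
    m1 < 1. *)
Lemma self_similar_0 : mu [set 0] = 0%E.
Proof.
have := muE (measurable_set1 (0 : R)).
rewrite [X in (_ + _ * X)%E](@self_similar_null _ (mpre _ _ (measurable_set1 _))); last first.
  move=> t /= tE; rewrite in_itv/= => /andP[t0 _].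
  by have := mulr_ge0 (ltW hr2) t0; move: hr1 hr; lra.
have -> : (fun t : R => r1 * t + 0) @^-1` [set 0] = [set 0].
  apply/seteqP; split => t /=; rewrite addr0.
    by move=> /eqP; rewrite mulf_eq0 gt_eqF//= => /eqP.
  by move=> ->; rewrite mulr0.
have : mu [set 0] \is a fin_num by rewrite fin_num_measure.
case: (mu [set 0]) => // x _; rewrite mule0 adde0 -EFinM => -[xE].
have /eqP : m2 * x = 0.
  have -> : m2 = 1 - m1 by rewrite -hm addrAC subrr add0r.
  by rewrite mulrBl mul1r {1}xE subrr.
by rewrite mulf_eq0 gt_eqF//= => /eqP ->.
Qed.
Let mu0 := self_similar_0.

(** Covers the case r1 + r2 = 1 of touching cells, in which the preimage under S_2 of a subset of
    the first cell may contain the point 0. *)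
Lemma self_similar_null_le0 (A : set (measurableTypeR R)) : measurable A ->
  A `<=` `]-oo, 0]%classic -> mu A = 0%E.
Proof.
move=> mA A0; apply/eqP; rewrite eq_le measure_ge0 andbT.
apply: (@le_trans _ _ (mu (`]-oo, 0[%classic `|` [set 0]))).
  apply: le_measure; rewrite ?inE//; first exact: measurableU.
  move=> t /A0/=; rewrite !in_itv/= le_eqVlt => /predU1P[->|]; [by right|by left].
have -> : mu (`]-oo, 0[%classic `|` [set 0]) = mu `]-oo, 0[%classic by exact: measureU0.
rewrite self_similar_null// => t /=; rewrite !in_itv/= => t0 /andP[/le_lt_trans/(_ t0)].
by rewrite ltxx.
Qed.

Let r1le : 0 <= r1 <= 1 - r2. Proof. by rewrite (ltW hr1) lerBrDr. Qed.
Let r2le : 1 - r2 <= 1. Proof. by rewrite gerBl ltW. Qed.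
Let r2ge : 0 <= 1 - r2. Proof. by case/andP: r1le => /le_trans; exact. Qed.
Let r2sum : 1 - r2 + r2 <= 1. Proof. by rewrite subrK. Qed.
Let r1sum : 0 + r1 <= 1. Proof. by rewrite add0r; case/andP: r1le => _ /le_trans; exact. Qed.

Let cell2_left (t : R) : r2 * t + (1 - r2) <= 1 - r2 -> t <= 0.
Proof. by rewrite gerDr pmulr_rle0. Qed.

Let cell1_right (t : R) : r1 < r1 * t -> t <= 1 -> False.
Proof. by rewrite -[ltLHS]mulr1 ltr_pM2l// => /lt_le_trans/[apply]; rewrite ltxx. Qed.

Lemma self_similar_scales1 : scales_by mu r1 0 m1.
Proof.
move=> A mA Asub; apply: (etrans (muE mA)).
rewrite [X in (_ + _ * X)%E]self_similar_null_le0 ?mule0 ?adde0//.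
  exact: mpre.
move=> t /= /Asub/=; rewrite !in_itv/= add0r => /andP[_ h].
by apply: cell2_left; rewrite (le_trans h)//; case/andP: r1le.
Qed.

Lemma self_similar_scales2 : scales_by mu r2 (1 - r2) m2.
Proof.
move=> A mA Asub; apply: (etrans (muE mA)).
rewrite [X in (_ * X + _)%E]self_similar_null ?mule0 ?add0e//.
  exact: mpre.
move=> t /= /Asub/=; rewrite !in_itv/= addr0 => /andP[h _] /andP[t0 t1].
by apply: cell1_right t1; apply: le_lt_trans h; case/andP: r1le.
Qed.

Lemma self_similar_gap : mu `]r1, 1 - r2]%classic = 0%E.
Proof.
rewrite muE//; rewrite [X in (_ * X + _)%E]self_similar_null.
- rewrite self_similar_null_le0 ?mule0 ?adde0//; first exact: mpre.
  by move=> t /=; rewrite !in_itv/= => /andP[_ h]; exact: cell2_left.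
- exact: mpre.
- move=> t /=; rewrite !in_itv/= addr0 => /andP[h _] /andP[t0 t1].
  exact: cell1_right h t1.
Qed.

Let rho := r1 * m1.

Let cos_sum0 L : cos_sum mu L 0 = 1.
Proof.
have [_ _ h _] := cos_solution mu01 L.
by rewrite h ?lexx ?ler01// (cumint_at0 _ (lebesgue_measure_set1 0)) addr0.
Qed.

Let cos_deriv0 L : cos_deriv mu L 0 = 0.
Proof. by rewrite /cos_deriv cumint_at0 ?mulr0//; exact: mu0. Qed.

Lemma cos_left L (x : R) : 0 <= x <= 1 ->
  cos_sum mu L (r1 * x) = cos_sum mu (rho * L) x /\
  r1 * cos_deriv mu L (r1 * x) = cos_deriv mu (rho * L) x.
Proof.
move=> x01.
have := solution_affine hr1 (lexx 0) r1sum (ltW hm1) mu01 mu0 self_similar_scales1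
  (@lebesgue_scales_by _ _ 0 hr1) (cos_solution mu01 L).
rewrite cos_sum0 cos_deriv0 mulr0 => s.
by have := solution_unique mu01 s x01; rewrite addr0 !mul1r.
Qed.

Let deriv_gap L (x : R) : r1 <= x <= 1 - r2 -> cos_deriv mu L x = cos_deriv mu L r1.
Proof.
move=> /andP[rx xr]; have /andP[r10 _] := r1le; rewrite /cos_deriv; congr (_ * _).
apply: cumint_gap => //; first by rewrite r10 rx.
- exact: le_trans r2le.
- exact: bounded_measurable_cos_sum.
- apply/eqP; rewrite eq_le measure_ge0 andbT -self_similar_gap; apply: le_measure; rewrite ?inE//.
  by move=> t /=; rewrite !in_itv/= => /andP[-> /le_trans->].
Qed.

(** As mu vanishes on the gap, c_L' keeps there its value at r1, which is G(rho L) / r1 by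
    [cos_left]; this gives the initial slope. The parameter is the same as on the left because r1 m1
    = r2 m2. *)
Lemma right_solution L :
  solution mu (rho * L) (cos_sum mu L (1 - r2)) (r2 / r1 * cos_deriv mu (rho * L) 1)
    (fun x => cos_sum mu L (r2 * x + (1 - r2)))
    (fun x => r2 * cos_deriv mu L (r2 * x + (1 - r2))).
Proof.
have := solution_affine hr2 r2ge r2sum (ltW hm2) mu01 mu0 self_similar_scales2
  (@lebesgue_scales_by _ _ _ hr2) (cos_solution mu01 L).
rewrite /rho hrm deriv_gap; last by rewrite lexx andbT; case/andP: r1le.
rewrite -hrm -(proj2 (cos_left L in1)) mulr1 mulrA divfK// gt_eqF//.
Qed.

(** When G(rho L) = 0 the slope vanishes throughout the gap, so c_L is constant there and the right
    piece starts with zero slope; uniqueness then identifies it. *)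
Lemma cos_lift L : cos_deriv mu (rho * L) 1 = 0 ->
  (forall x, r1 <= x <= 1 - r2 -> cos_sum mu L x = cos_sum mu (rho * L) 1) /\
  (forall x, 0 <= x <= 1 ->
    cos_sum mu L (r2 * x + (1 - r2)) =
      cos_sum mu (rho * L) 1 * cos_sum mu (rho * L) x /\
    r2 * cos_deriv mu L (r2 * x + (1 - r2)) =
      cos_sum mu (rho * L) 1 * cos_deriv mu (rho * L) x).
Proof.
move=> d1; have gap x : r1 <= x <= 1 - r2 -> cos_sum mu L x = cos_sum mu (rho * L) 1.
  move=> /andP[rx xr]; have /andP[r10 _] := r1le.
  have x1 : x <= 1 := le_trans xr r2le.
  have <- : cos_sum mu L r1 = cos_sum mu (rho * L) 1.
    by have [<- _] := cos_left L in1; rewrite mulr1.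
  have [_ bd hc _] := cos_solution mu01 L.
  rewrite hc ?(le_trans r10)// hc ?r10 ?(le_trans rx)//; congr (_ + _).
  have r1x : 0 <= r1 <= x by rewrite r10.
  rewrite (cumint_split leb01 r1x x1 bd) (@eq_Rintegral _ _ _ _ _ (fun=> 0)).
    by rewrite Rintegral_cst// mul0r addr0.
  move=> t /set_mem/=; rewrite in_itv/= => /andP[rt tx].
  rewrite deriv_gap ?(ltW rt) ?(le_trans tx)//.
  have := proj2 (cos_left L in1); rewrite d1 mulr1 => /eqP.
  by rewrite mulf_eq0 gt_eqF//= => /eqP.
split=> // x x01; have := right_solution L.
rewrite d1 mulr0 gap; last by rewrite lexx andbT; case/andP: r1le.
by move=> s; have := solution_unique mu01 s x01.
Qed.

Lemma cos_deriv_lift L : cos_deriv mu (rho * L) 1 = 0 -> cos_deriv mu L 1 = 0.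
Proof.
move=> d1; have [_ /(_ _ in1)[_]] := cos_lift d1.
rewrite d1 mulr0 mulr1 addrC subrK => /eqP.
by rewrite mulf_eq0 gt_eqF//= => /eqP.
Qed.

Lemma cos_sum1_lift L : cos_deriv mu (rho * L) 1 = 0 ->
  cos_sum mu L 1 = cos_sum mu (rho * L) 1 ^+ 2.
Proof.
move=> d1; have [_ /(_ _ in1)[]] := cos_lift d1.
by rewrite mulr1 addrC subrK => -> _; rewrite expr2.
Qed.

(* Lagrange's identity for the two copies of the solution on the cells
   [S_1 [0, 1]] and [S_2 [0, 1]], which share the spectral parameter
   [rho * L]; their derivatives are linked across the gap. *)
Lemma cos_sum1_nonlift L : cos_deriv mu L 1 = 0 -> cos_deriv mu (rho * L) 1 != 0 ->
  cos_sum mu L 1 = - (m1 / m2).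
Proof.
move=> d0 d1.
have := lagrange mu01 (cos_solution mu01 (rho * L)) (right_solution L).
rewrite subrr mul0r mulr1 (_ : r2 + (1 - r2) = 1); last by rewrite addrC subrK.
rewrite d0 mulr0 !mul0r subr0 sub0r mulr1 opprK => /eqP.
rewrite mulrC -mulrDl mulf_eq0 (negPf d1) orbF addr_eq0 => /eqP ->.
congr (- _); apply/eqP; rewrite eqr_div ?(gt_eqF hr1) ?(gt_eqF hm2)//.
by rewrite -hrm mulrC.
Qed.

(** Split [0,1] at r1 and 1 - r2: both cells rescale, and the gap carries no mass. *)
Lemma cumint_self_similar h : bounded_measurable h ->
  cumint mu h 1 = m1 * cumint mu (fun x => h (r1 * x)) 1 +
                  m2 * cumint mu (fun x => h (r2 * x + (1 - r2))) 1.
Proof.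
move=> bh; have h2 := cumint_affine hr2 r2ge r2sum (ltW hm2) mu01 mu0
  self_similar_scales2 in1 bh.
rewrite mulr1 (_ : r2 + (1 - r2) = 1) in h2; last by rewrite addrC subrK.
rewrite h2 (cumint_gap mu01 r1le r2le bh self_similar_gap); congr (_ + _).
have := cumint_affine hr1 (lexx 0) r1sum (ltW hm1) mu01 mu0
  self_similar_scales1 in1 bh.
rewrite mulr1 addr0 cumint_at0 ?add0r// => ->; congr (_ * cumint mu _ _).
by apply/funext => x; rewrite addr0.
Qed.

Lemma cos_norm_lift L : cos_deriv mu (rho * L) 1 = 0 ->
  cumint mu (fun x => cos_sum mu L x ^+ 2) 1 =
  (m1 + m2 * cos_sum mu (rho * L) 1 ^+ 2) *
  cumint mu (fun x => cos_sum mu (rho * L) x ^+ 2) 1.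
Proof.
move=> d1; have bc K := bounded_measurable_cos_sum mu01 K.
have b2 K : bounded_measurable (fun x => cos_sum mu K x ^+ 2).
  exact: (bounded_measurableM (bc K) (bc K)).
rewrite mulrDl -[m2 * _ * _]mulrA.
apply: (etrans (cumint_self_similar (b2 L))); congr (_ * _ + _ * _).
  by apply: eq_cumint => // t t01; rewrite (proj1 (cos_left L t01)).
rewrite -cumintZ//; apply: eq_cumint => // t t01.
by have [_ /(_ _ t01)[-> _]] := cos_lift d1; rewrite exprMn.
Qed.

End self_similarity.

(** * The sequence of Neumann eigenvalues *)

Section neumann_sequence.
Context {R : realType} (r1 r2 m1 m2 : R) (mu : probability (measurableTypeR R) R).
Hypotheses (hr1 : 0 < r1) (hr2 : 0 < r2) (hm1 : 0 < m1) (hm2 : 0 < m2).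
Hypotheses (hr : r1 + r2 <= 1) (hm : m1 + m2 = 1) (hrm : r1 * m1 = r2 * m2).
Hypothesis hmu : self_similar_measure r1 r2 m1 m2 mu.
Variable lam : nat -> R.
Hypothesis hlam : neumann_eigenvalue_sequence mu lam.

Notation I01 := (`[(0:R), 1]%classic).
Let mu01 : mu I01 = 1%E := proj1 hmu.
Let mu0 : mu [set 0] = 0%E := self_similar_0 hr1 hr2 hm2 hr hm hmu.
Let rho := r1 * m1.
Let rho_gt0 : 0 < rho. Proof. exact: mulr_gt0. Qed.

Let lam_homo : {homo lam : i j / (i < j)%N >-> i < j} := proj1 hlam.

Let lam_mono : {mono lam : i j / (i < j)%N >-> i < j}.
Proof.
move=> i j; case: (ltngtP i j) => [/lam_homo//|/lam_homo ji|->]; last by rewrite ltxx.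
by apply/negbTE; rewrite -leNgt ltW.
Qed.

Let lam_inj : injective lam.
Proof.
move=> i j e; case: (ltngtP i j) => // /lam_homo; by rewrite e ltxx.
Qed.

Lemma cos_deriv_lam i : cos_deriv mu (lam i) 1 = 0.
Proof.
apply/(neumann_eigenvalueP mu01 mu0); rewrite -(proj2 hlam); by exists i.
Qed.

Lemma cos_deriv_eq0_lam L : cos_deriv mu L 1 = 0 -> exists i, lam i = L.
Proof.
move=> /(neumann_eigenvalueP mu01 mu0); rewrite -(proj2 hlam) => -[i _ <-].
by exists i.
Qed.

Lemma lam_ge0 i : 0 <= lam i.
Proof.
rewrite leNgt; apply/negP => /(cos_deriv_gt0 mu01).
by rewrite cos_deriv_lam ltxx.
Qed.

Lemma lam_0 : lam 0 = 0.
Proof.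
have [|i li] := @cos_deriv_eq0_lam 0; first by rewrite /cos_deriv oppr0 mul0r.
apply/eqP; rewrite eq_le lam_ge0 andbT -[leRHS]li.
by case: i {li} => // i; exact/ltW/lam_homo.
Qed.

(** Induction from c_0 = 1: since [lam] enumerates all zeros of G in increasing order, neighbouring
    terms are consecutive zeros and the sign flips. *)
Lemma cos_sum1_sign i : 0 < (-1) ^+ i * cos_sum mu (lam i) 1.
Proof.
elim: i => [|i ih].
  by rewrite lam_0 (cos_sum_volterra mu01) ?lexx ?ler01// mul0r subr0 mulr1.
have := @consecutive_zeros_sign _ mu mu01 (lam i) (lam i.+1) (lam_homo (ltnSn i))
  (cos_deriv_lam i) (cos_deriv_lam i.+1).
have no K : lam i < K < lam i.+1 -> cos_deriv mu K 1 != 0.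
  move=> /andP[iK Ki]; apply/eqP => /cos_deriv_eq0_lam[j jK].
  by move: iK Ki; rewrite -jK !lam_mono ltnS => /leq_trans/[apply]; rewrite ltnn.
move=> /(_ no); rewrite exprS mulN1r mulNr oppr_gt0 => neg.
by rewrite -(pmulr_rlt0 _ ih) mulrACA -expr2 sqrr_sign mul1r.
Qed.

(** The end value is a square if rho times the eigenvalue is again an eigenvalue, and -m1/m2
    otherwise; its sign, known from [cos_sum1_sign], decides which case occurs. *)
Lemma cos_deriv_rho_lam i : (cos_deriv mu (rho * lam i) 1 == 0) = ~~ odd i.
Proof.
have s := cos_sum1_sign i.
apply/eqP/idP => [d1|].
  apply/negP => oi; move: s; rewrite -signr_odd oi expr1 mulN1r oppr_gt0.
  rewrite (cos_sum1_lift hr1 hr2 hm1 hm2 hr hm hrm hmu d1).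
  by rewrite ltNge sqr_ge0.
apply: contraNeq => d1; move: s.
rewrite (cos_sum1_nonlift hr1 hr2 hm1 hm2 hr hm hrm hmu (cos_deriv_lam i) d1).
rewrite -signr_odd; case: (odd i) => //=; rewrite expr0 mul1r oppr_gt0.
by rewrite ltNge divr_ge0// ltW.
Qed.

Let homo_ge (f : nat -> nat) : {homo f : i j / (i < j)%N >-> (i < j)%N} ->
  forall i, (i <= f i)%N.
Proof. by move=> hf; elim=> // i ih; exact: leq_ltn_trans ih (hf _ _ (ltnSn i)). Qed.

(* The even-indexed eigenvalues are those for which rho * lambda is again an
   eigenvalue, and every eigenvalue arises so; both sides being enumerated
   increasingly, the indices match. *)
Lemma rho_lam_double i : rho * lam (2 * i) = lam i.
Proof.
have ev j : ~~ odd (2 * j) by rewrite mul2n odd_double.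
have /boolp.choice[psi hpsi] : forall n, exists m, lam m = rho * lam (2 * n).
  by move=> n; apply: cos_deriv_eq0_lam; apply/eqP; rewrite cos_deriv_rho_lam.
(* Surjectivity of [psi]: the number lam n / rho is an eigenvalue by [cos_deriv_lift], and its index
   is even by [cos_deriv_rho_lam]. *)
have /boolp.choice[phi hphi] : forall n, exists m, psi m = n.
  move=> n.
  have d : cos_deriv mu (rho * (rho^-1 * lam n)) 1 = 0.
    by rewrite mulVKf ?gt_eqF// cos_deriv_lam.
  have [j jE] := cos_deriv_eq0_lam (cos_deriv_lift hr1 hr2 hm1 hm2 hr hm hrm hmu d).
  have : ~~ odd j by rewrite -cos_deriv_rho_lam jE; apply/eqP.
  move=> /even_halfK jh; exists j./2; apply: lam_inj.
  by rewrite hpsi mul2n jh jE mulVKf// gt_eqF.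
have psi_homo : {homo psi : a b / (a < b)%N >-> (a < b)%N}.
  by move=> a b ab; rewrite -lam_mono !hpsi ltr_pM2l// lam_mono ltn_pmul2l.
have phi_homo : {homo phi : a b / (a < b)%N >-> (a < b)%N}.
  move=> a b; rewrite -{1}(hphi a) -{1}(hphi b).
  by case: (ltngtP (phi a) (phi b)) => // [/psi_homo/ltnW h|->]; rewrite ltnNge ?h ?leqnn.
(* Increasing maps dominate the identity, so i <= phi i <= psi (phi i) = i. *)
have /eqP phiE : phi i == i.
  by rewrite eqn_leq homo_ge// andbT -{2}(hphi i) homo_ge.
by rewrite -hpsi -{1}phiE hphi.
Qed.

Definition end_value i := cos_sum mu (lam i) 1.

Lemma end_value_odd i : odd i -> end_value i = - (m1 / m2).
Proof.
move=> oi; apply: (cos_sum1_nonlift hr1 hr2 hm1 hm2 hr hm hrm hmu (cos_deriv_lam i)).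
by rewrite -/rho cos_deriv_rho_lam oi.
Qed.

Let dlam i : cos_deriv mu (rho * lam (2 * i)) 1 = 0.
Proof. by rewrite rho_lam_double cos_deriv_lam. Qed.

Lemma end_value_double i : end_value (2 * i) = end_value i ^+ 2.
Proof.
by rewrite /end_value (cos_sum1_lift hr1 hr2 hm1 hm2 hr hm hrm hmu (dlam i)) rho_lam_double.
Qed.

Lemma normalized_eigenfunctionE i :
  normalized_eigenfunction mu lam i = fun x =>
  (Num.sqrt (cumint mu (fun t => cos_sum mu (lam i) t ^+ 2) 1))^-1 *
  cos_sum mu (lam i) x.
Proof.
have fE : neumann_eigenfunction mu lam i = cos_sum mu (lam i).
  by apply/funext => x; rewrite /neumann_eigenfunction c_funE// lam_ge0.
rewrite /normalized_eigenfunction fE /L2_norm Lnorm2_cumint//.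
exact: bounded_measurable_cos_sum.
Qed.

(** The first pointwise hypothesis gives one inequality and the second gives the other; no supremum
    has to be finite or attained. *)
Lemma sup_norm_scale (F f : R -> R) (c : R) : 0 < c ->
  (forall x, 0 <= x <= 1 -> exists2 y, 0 <= y <= 1 & `|F y| = c * `|f x|) ->
  (forall y, 0 <= y <= 1 -> exists2 x, 0 <= x <= 1 & `|F y| <= c * `|f x|) ->
  sup_norm F = (c%:E * sup_norm f)%E.
Proof.
move=> c0 h1 h2; rewrite /sup_norm -ereal_supZl//; last 2 first.
- by apply/set0P; exists `|f 0|%:E; exists 0 => //; apply/mem_itv01; rewrite lexx ler01.
- exact: ltW.
apply/eqP; rewrite eq_le; apply/andP; split; apply: ge_ereal_sup.
- move=> _ [y /mem_itv01/h2[x x01 Fy] <-]; apply: (@le_trans _ _ (c%:E * `|f x|%:E)%E).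
    by rewrite -EFinM lee_fin.
  apply: ereal_sup_ubound; exists `|f x|%:E => //; exists x => //; exact/mem_itv01.
- move=> _ [_ [x /mem_itv01/h1[z z01 Fz] <-] <-]; rewrite -EFinM -Fz.
  by apply: ereal_sup_ubound; exists z => //; exact/mem_itv01.
Qed.

(** With an end value of modulus at most 1, the left cell already realises the supremum, so only the
    normalising constants differ. *)
Lemma sup_norm_double i : `|end_value i| <= 1 ->
  sup_norm (normalized_eigenfunction mu lam (2 * i)) =
  (((Num.sqrt (m1 + m2 * end_value i ^+ 2))^-1)%:E *
    sup_norm (normalized_eigenfunction mu lam i))%E.
Proof.
move=> ai1; set K := m1 + _.
have K0 : 0 < K by rewrite ltr_wpDr// mulr_ge0 ?sqr_ge0// ltW.
have sK0 : 0 < (Num.sqrt K)^-1 by rewrite invr_gt0 sqrtr_gt0.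
pose N j := (Num.sqrt (cumint mu (fun t => cos_sum mu (lam j) t ^+ 2) 1))^-1.
have NE j : normalized_eigenfunction mu lam j = fun x => N j * cos_sum mu (lam j) x.
  exact: normalized_eigenfunctionE.
have N0 j : 0 <= N j by rewrite invr_ge0 sqrtr_ge0.
have N2 : N (2 * i)%N = (Num.sqrt K)^-1 * N i.
  rewrite /N (cos_norm_lift hr1 hr2 hm1 hm2 hr hm hrm hmu (dlam i)) -/rho.
  by rewrite rho_lam_double sqrtrM ?invfM// ltW.
have left x : 0 <= x <= 1 -> cos_sum mu (lam (2 * i)%N) (r1 * x) = cos_sum mu (lam i) x.
  move=> x01; have [-> _] := cos_left hr1 hr2 hm1 hm2 hr hm hmu (lam (2 * i)%N) x01.
  by rewrite -/rho rho_lam_double.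
have [gap right] := cos_lift hr1 hr2 hm1 hm2 hr hm hrm hmu (dlam i).
rewrite -/rho rho_lam_double in gap right.
have scale a : `|N (2 * i)%N * a| = (Num.sqrt K)^-1 * (N i * `|a|).
  by rewrite normrM (ger0_norm (N0 _)) N2 mulrA.
rewrite !NE; apply: sup_norm_scale => //.
- move=> x x01; have /andP[x0 x1] := x01; exists (r1 * x).
    by rewrite mulr_ge0 ?(ltW hr1)//= mulr_ile1 ?(ltW hr1)// (le_trans _ hr)// lerDl ltW.
  by rewrite (left _ x01) scale normrM (ger0_norm (N0 i)).
- move=> y /andP[y0 y1].
  suff [x x01 h] : exists2 x, 0 <= x <= 1 &
      `|cos_sum mu (lam (2 * i)%N) y| <= `|cos_sum mu (lam i) x|.
    by exists x => //; rewrite scale normrM (ger0_norm (N0 i)) !ler_wpM2l// ltW.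
  (* On the left cell f_(2i) is a copy of f_i, on the gap it is the constant f_i(1), and on the
     right cell it is a copy scaled by the end value. *)
  have [yr|ry] := leP y r1.
    have x01 : 0 <= r1^-1 * y <= 1.
      by rewrite mulr_ge0 ?invr_ge0 ?(ltW hr1)//= mulrC ler_pdivrMr// mul1r.
    by exists (r1^-1 * y) => //; rewrite -left// mulVKf// gt_eqF.
  have [yr|ry'] := leP y (1 - r2).
    by exists 1; rewrite ?ler01 ?lexx// gap// yr ltW.
  have x01 : 0 <= (y - (1 - r2)) / r2 <= 1.
    rewrite divr_ge0 ?(ltW hr2) ?subr_ge0 ?(ltW ry')//= ler_pdivrMr// mul1r.
    by rewrite lerBlDr addrC subrK.
  exists ((y - (1 - r2)) / r2) => //.
  have [+ _] := right _ x01; rewrite mulrC divfK ?gt_eqF// subrK => ->.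
  by rewrite normrM ler_piMl.
Qed.

End neumann_sequence.

(** * Growth of the sup norms under repeated doubling of the index *)

Lemma sup_norm_ge0 {R : realType} (f : R -> R) : (0 <= sup_norm f)%E.
Proof.
apply: (@le_trans _ _ `|f 0|%:E); first by rewrite lee_fin.
by apply: ereal_sup_ubound; exists 0 => //; apply/mem_itv01; rewrite lexx ler01.
Qed.

Theorem corollary8p7 (R : realType) (r1 r2 m1 m2 : R)
    (hr1 : 0 < r1) (hr2 : 0 < r2) (hm1 : 0 < m1) (hm2 : 0 < m2)
    (hr : r1 + r2 <= 1) (hm : m1 + m2 = 1) (hrm : r1 * m1 = r2 * m2)
    (mu : probability (measurableTypeR R) R)
    (hmu : self_similar_measure r1 r2 m1 m2 mu)
    (lam : nat -> R) (hlam : neumann_eigenvalue_sequence mu lam)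
    (l : nat) (hl : odd l) :
  (m1 = m2 ->
    forall k : nat, (0 < k)%N ->
      sup_norm (normalized_eigenfunction mu lam (2 ^ k * l)) =
      sup_norm (normalized_eigenfunction mu lam l)) /\
  (m1 < m2 ->
    let C := 1 / Num.sqrt (m1 * (1 + m1 / m2)) in
    [/\ 1 < C,
        forall k : nat, (0 < k)%N ->
          ((C ^+ k)%:E * sup_norm (normalized_eigenfunction mu lam l) <=
           sup_norm (normalized_eigenfunction mu lam (2 ^ k * l)))%E &
        forall k : nat, (0 < k)%N ->
          (sup_norm (normalized_eigenfunction mu lam (2 ^ k * l)) <=
           (m1 `^ (- (k%:R / 2)) *
            (m2 / m1) `^ (k%:R / 2 * (2 ^+ k - 1)))%:E *
           sup_norm (normalized_eigenfunction mu lam l))%E]).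
Proof.
pose s i := sup_norm (normalized_eigenfunction mu lam i).
pose a i := end_value mu lam i.
(* The growth factor of the sup norm in passing from index i to 2i, valid while |a i| <= 1. *)
pose c i := (Num.sqrt (m1 + m2 * a i ^+ 2))^-1.
have s0 i : (0 <= s i)%E by exact: sup_norm_ge0.
have a_odd : a l = - (m1 / m2).
  exact: (end_value_odd hr1 hr2 hm1 hm2 hr hm hrm hmu hlam).
have a_double i : a (2 * i)%N = a i ^+ 2.
  exact: (end_value_double hr1 hr2 hm1 hm2 hr hm hrm hmu hlam).
have s_double i : `|a i| <= 1 -> s (2 * i)%N = ((c i)%:E * s i)%E.
  exact: (sup_norm_double hr1 hr2 hm1 hm2 hr hm hrm hmu hlam).
have pow2S k : (2 ^ k.+1 * l = 2 * (2 ^ k * l))%N by rewrite expnS mulnA.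
split=> [m12 k _|m12 C].
  have q1 : m1 / m2 = 1 by rewrite m12 divff// gt_eqF.
  (* All end values have modulus 1, so every growth factor is 1 / sqrt (m1 + m2) = 1. *)
  have a2 j : a (2 ^ j * l)%N ^+ 2 = 1.
    elim: j => [|j ih]; first by rewrite mul1n a_odd q1 sqrrN expr1n.
    by rewrite pow2S a_double ih expr1n.
  elim: k => [|k ih]; first by rewrite mul1n.
  have a1 : `|a (2 ^ k * l)%N| <= 1.
    by rewrite -(@expr_le1 _ 2)// real_normK ?num_real// a2.
  rewrite pow2S -ih -!/(s _) (s_double _ a1) /c a2 mulr1 hm sqrtr1 invr1.
  exact: mul1e.
have q0 : 0 < m1 / m2 by rewrite divr_gt0.
have q1 : m1 / m2 < 1 by rewrite ltr_pdivrMr// mul1r.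
(* Doubling the index squares the end value, which starts at -m1/m2 of modulus below 1 and so only
   shrinks. *)
have a2 j : a (2 ^ j * l)%N ^+ 2 <= (m1 / m2) ^+ 2.
  elim: j => [|j ih]; first by rewrite mul1n a_odd sqrrN.
  rewrite pow2S a_double; apply: (le_trans _ ih).
  rewrite expr2 ler_piMr ?sqr_ge0//; apply: (le_trans ih).
  by rewrite exprn_ile1// ltW.
have a1 j : `|a (2 ^ j * l)%N| <= 1.
  rewrite -(@ler_pXn2r _ 2) ?nnegrE// real_normK ?num_real// expr1n.
  by apply: (le_trans (a2 j)); rewrite exprn_ile1// ltW.
(* [C] is the growth factor of the first doubling, where the end value is -m1/m2. *)
have CE : C = (Num.sqrt (m1 + m2 * (m1 / m2) ^+ 2))^-1.
  rewrite /C div1r; congr (Num.sqrt _)^-1.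
  by field; rewrite gt_eqF.
have C1 : 1 < C.
  rewrite /C div1r invf_gt1; last first.
    by rewrite sqrtr_gt0 mulr_gt0// addr_gt0.
  (* This uses m1 + m2 = 1, so that C^2 = m2 / m1. *)
  have -> : m1 * (1 + m1 / m2) = m1 / m2.
    by rewrite mulrDr mulr1 -[X in X + _](divfK (lt0r_neq0 hm2)) [m1 * _]mulrC
      -mulrDr addrC hm mulr1.
  by rewrite -sqrtr1 ltr_sqrt.
have C_le j : C <= c (2 ^ j * l)%N.
  have K0 (x : R) : 0 < m1 + m2 * x ^+ 2.
    by rewrite ltr_wpDr// mulr_ge0 ?sqr_ge0// ltW.
  rewrite CE /c lef_pV2 ?posrE ?sqrtr_gt0// ler_sqrt ?(ltW (K0 _))//.
  by rewrite lerD2l ler_wpM2l ?a2// ltW.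
have c_le j : c (2 ^ j * l)%N <= (Num.sqrt m1)^-1.
  have K0 (x : R) : 0 <= m2 * x ^+ 2 by rewrite mulr_ge0 ?sqr_ge0// ltW.
  rewrite /c lef_pV2 ?posrE ?sqrtr_gt0 ?ler_sqrt ?lerDl ?addr_ge0 ?K0 ?(ltW hm1)// ltr_wpDr ?K0//.
have C0 : 0 <= C := ltW (lt_trans ltr01 C1).
split=> // k _.
  rewrite -!/(s _); elim: k => [|k ih]; first by rewrite mul1n expr0 mul1e.
  rewrite pow2S (s_double _ (a1 k)) exprS EFinM -muleA.
  apply: (lee_pmul _ _ _ ih); rewrite ?lee_fin; first exact: C0.
    by apply: mule_ge0 (s0 l); rewrite lee_fin exprn_ge0.
  exact: C_le.
(* Omitting the term with the end value bounds each growth factor by m1^(-1/2). The remaining factor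
   of the claim is a power of m2 / m1 >= 1 with nonnegative exponent, hence at least 1. *)
rewrite -!/(s _); have upper : (s (2 ^ k * l)%N <= ((Num.sqrt m1)^-1 ^+ k)%:E * s l)%E.
  elim: k => [|k ih]; first by rewrite mul1n expr0 mul1e.
  rewrite pow2S (s_double _ (a1 k)) exprS EFinM -muleA.
  apply: (lee_pmul _ (s0 _) _ ih); rewrite lee_fin; last exact: c_le.
  exact: le_trans C0 (C_le _).
apply: (le_trans upper); rewrite lee_wpmul2r// lee_fin.
have -> : m1 `^ (- (k%:R / 2)) = (Num.sqrt m1)^-1 ^+ k.
  rewrite powRN mulrC powRrM powR12_sqrt ?ltW// powR_mulrn ?sqrtr_ge0//.
  by rewrite exprVn.
rewrite ler_peMr ?exprn_ge0 ?invr_ge0 ?sqrtr_ge0//.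
rewrite -[leLHS](powRr0 (m2 / m1)) ler_powR//.
  by rewrite ler_pdivlMr// mul1r ltW.
by rewrite mulr_ge0 ?divr_ge0// subr_ge0 exprn_ege1// ler1n.
Qed.
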